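(* Let $r\ge 2$ and $s\ge 2$ be integers with $s\ge r$. Then there are uncountably many pairwise inequivalent proper holomorphic maps from $\Omega_{r,s}^{I}$ to $\Omega_{2r-1,2s}^{I}$.
   Context: For integers $s\ge r\ge 1$, $\Omega_{r,s}^{I} = \{ Z\in M_{r,s}^{\mathbb{C}} : I_r - ZZ^* >0 \}$, where $M_{r,s}^{\mathbb{C}}$ is the set of $r\times s$ complex matrices, $I_r$ is the identity matrix, $Z^*$ is the conjugate transpose, and $>0$ means positive definite. A map $f:\Omega_1\to\Omega_2$ between domains is proper if $f^{-1}(K)$ is compact for every compact $K\subset\Omega_2$. $\mathrm{Aut}(\Omega)$ is the group of holomorphic automorphisms (biholomorphic self-maps) of $\Omega$. Holomorphic maps $f,g:\Omega_1\to\Omega_2$ are equivalent if $f=A\circ g\circ B$ for some $A\in\mathrm{Aut}(\Omega_2)$ and $B\in\mathrm{Aut}(\Omega_1)$, and inequivalent otherwise. *)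

(* Defs.v *)
From HB Require Import structures.
From mathcomp Require Import all_boot all_order all_algebra.
From mathcomp Require Import complex.
From mathcomp Require Import all_classical all_reals all_analysis.

Set Implicit Arguments.
Unset Strict Implicit.
Unset Printing Implicit Defensive.

Import Order.TTheory GRing.Theory Num.Theory.
Import numFieldNormedType.Exports.

Local Open Scope classical_set_scope.
Local Open Scope ring_scope.
Local Open Scope complex_scope.
Local Open Scope sesquilinear_scope.

(* The order of [R[i]] is partial: [0 < z] says that [z] is real and positive. *)
Definition posdefmx (R : realType) (n : nat) (M : 'M[R[i]]_n) : Prop :=
  M ^t* = M /\ forall u : 'rV[R[i]]_n, u != 0 -> 0 < (u *m M *m u ^t*) 0 0.

Definition Omega_I (R : realType) (r s : nat) : set 'M[R[i]]_(r, s) :=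
  [set Z | posdefmx (1%:M - Z *m Z ^t*)].
Arguments Omega_I : clear implicits.

(* A map between the domains [D1] and [D2] is represented by a total function
   on the ambient spaces; only its values on [D1] matter.  All the domains
   considered are open, so that differentiability at a point of [D1] does not
   depend on the values taken outside of [D1]. *)
Section Maps.
Context {R : realType} {V W : normedModType R[i]}.

(* Since the scalars are complex, [differentiable] is Frechet differentiability
   with a complex-linear differential. *)
Definition holomorphic_map (D1 : set V) (D2 : set W) (f : V -> W) : Prop :=
  {homo f : x / D1 x >-> D2 x} /\ forall x, D1 x -> differentiable f x.

Definition proper_map (D1 : set V) (D2 : set W) (f : V -> W) : Prop :=
  forall K : set W, K `<=` D2 -> compact K -> compact (D1 `&` f @^-1` K).

End Maps.

Definition Aut (R : realType) (V : normedModType R[i]) (D : set V) :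
    set (V -> V) :=
  [set A | holomorphic_map D D A /\
     exists B : V -> V, [/\ holomorphic_map D D B,
       forall x, D x -> B (A x) = x & forall x, D x -> A (B x) = x]].

Definition equivalent_maps (R : realType) (V W : normedModType R[i])
    (D1 : set V) (D2 : set W) (f g : V -> W) : Prop :=
  exists A B, [/\ Aut D2 A, Aut D1 B &
    forall x, D1 x -> f x = A (g (B x))].

(* Main.v *)
Require Import Defs.
From HB Require Import structures.
From mathcomp Require Import all_boot all_order all_algebra.
From mathcomp Require Import complex.
From mathcomp Require Import all_classical all_reals all_analysis.
From mathcomp Require Import ring lra.

Set Implicit Arguments.
Unset Strict Implicit.
Unset Printing Implicit Defensive.

Import Order.TTheory GRing.Theory Num.Theory.
Import numFieldNormedType.Exports.

Local Open Scope classical_set_scope.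
Local Open Scope ring_scope.
Local Open Scope complex_scope.
Local Open Scope sesquilinear_scope.

Import Normc.

(** The maps are f_t (Z) = diag (Z, t z_00 E_00) for 0 < t < 1, with a second
    block of size (r - 1) x s.  Each f_t is linear, takes its values in the larger
    domain because both blocks are strict contractions, and is proper because its
    first block is the identity.

    Why t is an invariant up to equivalence.  Suppose f_y o B = A o f_x with A
    and B automorphisms.  Composing with Moebius maps of the matrix balls that
    send A 0 and B 0 to the origin, one may look at differentials at 0.  There
    the Schwarz lemma makes the differential L of the modified A a linear
    isometry for the operator norm, and likewise for B, and one finds
    L (diag (X, x X_00 E_00)) = diag (Y X, S X) with Y a surjective isometry and
    S of norm at most y; the last bound is Schwarz-Pick for the coefficient
    y z_00 ([corner_bound]).  Now let e = diag (0, E_00).  For every X in the unit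
    ball the vector diag (X, x X_00 E_00) can be moved by (1 - x) e in both
    directions without leaving the unit ball.  Since Y X is arbitrary in the unit
    ball, its image can be moved by (1 - x) L e only if L e is concentrated in
    the second block ([corner_vanish]).  Hence for X = E_00 the image of
    diag (E_00, x E_00) + e has norm at most 1 + y, while this vector has norm
    1 + x, and so x <= y ([corner_map_rigidity]).  By symmetry x = y, and there
    are uncountably many values of t.

    The analytic input is the inequality |h'(0)| <= sup |h| for a function h on
    the unit disc with h (0) = 0 that is complex differentiable at each point
    ([schwarz]).  It rests on Goursat's theorem ([goursat]), applied to
    h (exp z) / exp z on rectangles of height 2 pi.  The Moebius maps are the
    action of the pseudo-unitary matrices, with respect to diag (1, -1), on the
    row spaces of (1 Z) ([mobius_Aut], [diff_mobius_move]). *)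

(** * Goursat's theorem for closed forms on rectangles *)

Section SegmentIntegral.
Context {R : realType}.
Implicit Types (a b c d : R) (f g : R -> R).

(** Two-sided continuity at every point of the segment, end points included:
    stronger than continuity of the restriction, but inherited by subsegments
    by mere inclusion. *)
Definition cont_on f a b := {in `[a, b], continuous f}.

Definition segint a b f : R := \int[@lebesgue_measure R]_(x in `[a, b]) f x.

Lemma cont_on_sub f a b c d : a <= c -> d <= b -> cont_on f a b -> cont_on f c d.
Proof.
move=> ac db fab x; rewrite in_itv /= => /andP[cx xd]; apply: fab.
by rewrite in_itv /= (le_trans ac cx) (le_trans xd db).
Qed.

Lemma cont_on_integrable f a b :
  cont_on f a b -> (@lebesgue_measure R).-integrable `[a, b] (EFin \o f).
Proof.
move=> fab; apply: continuous_compact_integrable; first exact: segment_compact.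
by apply: continuous_in_subspaceT => x /set_mem; exact: fab.
Qed.

Lemma cont_onB f g a b : cont_on f a b -> cont_on g a b ->
  cont_on (fun x => f x - g x) a b.
Proof. by move=> fab gab x xab; apply: continuousB; [exact: fab|exact: gab]. Qed.

Lemma segint_cat f a b m : a <= m -> m <= b -> cont_on f a b ->
  segint a b f = segint a m f + segint m b f.
Proof.
move=> am mb fab; rewrite /segint.
have := @Rintegral_itvB R f (BLeft a) (BRight b) m.
rewrite !bnd_simp => /(_ (cont_on_integrable fab) am mb) /eqP.
rewrite subr_eq addrC => /eqP ->; congr (_ + _).
rewrite Rintegral_itv_obnd_cbnd //.
apply: integrableS (cont_on_integrable (cont_on_sub am (lexx b) fab)) => //.
by apply: subset_itvr; rewrite bnd_simp.
Qed.

Lemma segintB f g a b : cont_on f a b -> cont_on g a b ->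
  segint a b (fun x => f x - g x) = segint a b f - segint a b g.
Proof. by move=> fab gab; rewrite /segint RintegralB //; exact: cont_on_integrable. Qed.

Lemma segint_cst a b k : a <= b -> segint a b (fun=> k) = k * (b - a).
Proof.
move=> ab; rewrite /segint Rintegral_cst //= lebesgue_measure_itv /= lte_fin.
by case: ltP => // ba; rewrite (@le_anti _ _ a b) ?ab // subrr.
Qed.

(** Local bounds on circulations and bounds on the means over circles both reduce
    to a comparison with a constant. *)
Lemma segint_near_cst f a b k e : a <= b -> cont_on f a b ->
  (forall x, a <= x <= b -> `|f x - k| <= e) ->
  `|segint a b f - k * (b - a)| <= e * (b - a).
Proof.
move=> ab fab fk.
have cc j : cont_on (fun=> j : R) a b by move=> x _; exact: cst_continuous.
have up : segint a b f <= (k + e) * (b - a).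
  rewrite -segint_cst //; apply: le_Rintegral => //; try exact: cont_on_integrable.
  by move=> x /=; rewrite in_itv /= => /fk; rewrite ler_norml => /andP[? ?]; lra.
have dn : (k - e) * (b - a) <= segint a b f.
  rewrite -segint_cst //; apply: le_Rintegral => //; try exact: cont_on_integrable.
  by move=> x /=; rewrite in_itv /= => /fk; rewrite ler_norml => /andP[? ?]; lra.
by rewrite ler_norml; apply/andP; split; lra.
Qed.

End SegmentIntegral.

Lemma continuous_of_slope (R : realType) (f : R -> R) (x k d : R) : 0 < d ->
  (forall x', `|x' - x| <= d -> `|f x' - f x - k * (x' - x)| <= `|x' - x|) ->
  {for x, continuous f}.
Proof.
move=> d0 H; apply/cvgrPdist_le => e e0.
have k1 : 0 < 1 + `|k| by rewrite ltr_pwDl.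
near=> x'.
have xd : `|x' - x| <= d.
  near: x'; apply: (@cvgr_distC_le _ _ _ _ _ id x) => //; exact: cvg_id.
have xe : `|x' - x| <= e / (1 + `|k|).
  near: x'; apply: (@cvgr_distC_le _ _ _ _ _ id x); first exact: cvg_id.
  exact: divr_gt0.
rewrite ler_pdivlMr // mulrDr mulr1 in xe.
rewrite distrC; apply: le_trans xe.
rewrite -[f x' - f x](subrK (k * (x' - x))).
apply: le_trans (ler_normD _ _) _; rewrite normrM [`|k| * _]mulrC.
by rewrite lerD2r H.
Unshelve. all: by end_near. Qed.

Lemma dist_segment (R : realType) (a b x y : R) :
  a <= x <= b -> a <= y <= b -> `|x - y| <= b - a.
Proof.
by move=> /andP[? ?] /andP[? ?]; rewrite ler_norml; apply/andP; split; lra.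
Qed.

Lemma ler_norm_halfB (R : realType) (u v e : R) :
  `|u| <= e / 2 -> `|v| <= e / 2 -> `|u - v| <= e.
Proof.
move=> ue ve; apply: le_trans (ler_normB _ _) _.
by rewrite [e in leRHS]splitr; exact: lerD.
Qed.

Lemma norm_sum4_le (R : realType) (k1 k2 k3 k4 : R) (K := `|k1 + k2 + (k3 + k4)|) :
  [\/ K <= 4 * `|k1|, K <= 4 * `|k2|, K <= 4 * `|k3| | K <= 4 * `|k4|].
Proof.
have tri : K <= `|k1| + `|k2| + (`|k3| + `|k4|).
  by apply: le_trans (ler_normD _ _) _; apply: lerD; exact: ler_normD.
have [l1|l1] := leP K (4 * `|k1|); first by constructor 1.
have [l2|l2] := leP K (4 * `|k2|); first by constructor 2.
have [l3|l3] := leP K (4 * `|k3|); first by constructor 3.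
by constructor 4; lra.
Qed.

Section Goursat.
Context {R : realType}.
Variables P Q : R -> R -> R.

(** The form P dx + Q dy is differentiable at the point and closed there: the
    two cross partial derivatives are the same number r.  The derivatives exist
    point by point, without any continuity. *)
Definition closed_form_at (x0 y0 : R) := exists p r q : R,
  forall e, 0 < e -> exists2 d, 0 < d & forall x y,
    `|x - x0| <= d -> `|y - y0| <= d ->
    `|P x y - P x0 y0 - (p * (x - x0) + r * (y - y0))| <= e * (`|x - x0| + `|y - y0|)
    /\
    `|Q x y - Q x0 y0 - (r * (x - x0) + q * (y - y0))| <= e * (`|x - x0| + `|y - y0|).

Definition circulation (a b c d : R) : R :=
  segint a b (P^~ c) - segint a b (P^~ d) + (segint c d (Q b) - segint c d (Q a)).

Variables (a0 b0 c0 d0 : R).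
Hypotheses (ab0 : a0 <= b0) (cd0 : c0 <= d0).
Hypothesis PQ : forall x y, a0 <= x <= b0 -> c0 <= y <= d0 -> closed_form_at x y.

Lemma cont_on_horizontal y : c0 <= y <= d0 -> cont_on (P^~ y) a0 b0.
Proof.
move=> yI x; rewrite in_itv => xI; have [p [r [q /(_ 1 ltr01)[d dp H]]]] := PQ xI yI.
apply: (@continuous_of_slope _ _ _ p d dp) => x' xd.
have [] := H x' y xd; first by rewrite subrr normr0 ltW.
by rewrite subrr normr0 mulr0 !addr0 mul1r.
Qed.

Lemma cont_on_vertical x : a0 <= x <= b0 -> cont_on (Q x) c0 d0.
Proof.
move=> xI y; rewrite in_itv => yI; have [p [r [q /(_ 1 ltr01)[d dp H]]]] := PQ xI yI.
apply: (@continuous_of_slope _ _ _ q d dp) => y' yd.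
have [] := H x y' _ yd; first by rewrite subrr normr0 ltW.
by move=> _; rewrite subrr normr0 mulr0 !add0r mul1r.
Qed.

(** Affine closed forms have no circulation, so near a point where the form is
    differentiable only the o(distance) remainder counts, along a perimeter that
    is itself of the order of the diameter. *)
Lemma circulation_small x0 y0 e : a0 <= x0 <= b0 -> c0 <= y0 <= d0 -> 0 < e ->
  exists2 dl, 0 < dl & forall a b c d, a0 <= a -> b <= b0 -> c0 <= c -> d <= d0 ->
    a <= x0 <= b -> c <= y0 <= d -> b - a <= dl -> d - c <= dl ->
    `|circulation a b c d| <= e * (b - a + (d - c)) ^+ 2.
Proof.
move=> xI yI e0; have [p [r [q pq]]] := PQ xI yI.
have e2 : 0 < e / 2 by rewrite divr_gt0.
have [dl dl0 H] := pq _ e2.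
exists dl => // a b c d aa bb cc dd xab ycd bal dcl.
have [ab cd] : a <= b /\ c <= d.
  case/andP: xab => h1 h2; case/andP: ycd => h3 h4.
  by split; [exact: le_trans h1 h2|exact: le_trans h3 h4].
pose devP x y := P x y - P x0 y0 - (p * (x - x0) + r * (y - y0)).
pose devQ x y := Q x y - Q x0 y0 - (r * (x - x0) + q * (y - y0)).
pose K := e * (b - a + (d - c)).
have dev x y : a <= x <= b -> c <= y <= d ->
    `|devP x y| <= K / 2 /\ `|devQ x y| <= K / 2.
  move=> xab' ycd'.
  have xw := dist_segment xab' xab; have yw := dist_segment ycd' ycd.
  have [h1 h2] := H x y (le_trans xw bal) (le_trans yw dcl).
  have m : e / 2 * (`|x - x0| + `|y - y0|) <= K / 2.
    have -> : K / 2 = e / 2 * (b - a + (d - c)) by rewrite /K mulrAC.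
    by rewrite ler_pM2l // lerD.
  by split; [exact: le_trans h1 m|exact: le_trans h2 m].
have cI : c0 <= c <= d0 by rewrite cc (le_trans cd dd).
have dI : c0 <= d <= d0 by rewrite (le_trans cc cd) dd.
have aI : a0 <= a <= b0 by rewrite aa (le_trans ab bb).
have bI : a0 <= b <= b0 by rewrite (le_trans aa ab) bb.
have aab : a <= a <= b by rewrite lexx ab.
have bab : a <= b <= b by rewrite lexx ab.
have ccd : c <= c <= d by rewrite lexx cd.
have dcd : c <= d <= d by rewrite lexx cd.
have Pc := cont_on_sub aa bb (cont_on_horizontal cI).
have Pd := cont_on_sub aa bb (cont_on_horizontal dI).
have Qa := cont_on_sub cc dd (cont_on_vertical aI).
have Qb := cont_on_sub cc dd (cont_on_vertical bI).
rewrite /circulation -(segintB Pc Pd) -(segintB Qb Qa).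
(* The difference of the values on opposite sides is nearly constant, and the
   two constants contribute r (c - d) (b - a) and r (b - a) (d - c). *)
have h1 : `|segint a b (fun x => P x c - P x d) - r * (c - d) * (b - a)|
    <= K * (b - a).
  apply: segint_near_cst => //; first exact: cont_onB.
  move=> x xI'; have [k1 _] := dev x c xI' ccd; have [k2 _] := dev x d xI' dcd.
  have -> : P x c - P x d - r * (c - d) = devP x c - devP x d.
    by rewrite /devP; ring.
  exact: ler_norm_halfB.
have h2 : `|segint c d (fun y => Q b y - Q a y) - r * (b - a) * (d - c)|
    <= K * (d - c).
  apply: segint_near_cst => //; first exact: cont_onB.
  move=> y yI'; have [_ k1] := dev b y bab yI'; have [_ k2] := dev a y aab yI'.
  have -> : Q b y - Q a y - r * (b - a) = devQ b y - devQ a y.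
    by rewrite /devQ; ring.
  exact: ler_norm_halfB.
move: h1 h2; set I1 := segint a b _; set I2 := segint c d _ => h1 h2.
have -> : I1 + I2 = (I1 - r * (c - d) * (b - a)) + (I2 - r * (b - a) * (d - c)).
  by ring.
apply: le_trans (ler_normD _ _) _; apply: le_trans (lerD h1 h2) _.
by rewrite -mulrDr /K -mulrA -expr2.
Qed.

Lemma circulation_split_x a m b c d : a0 <= a -> a <= m -> m <= b -> b <= b0 ->
  c0 <= c -> c <= d -> d <= d0 ->
  circulation a b c d = circulation a m c d + circulation m b c d.
Proof.
move=> aa am mb bb cc cd dd; rewrite /circulation.
have cI : c0 <= c <= d0 by rewrite cc (le_trans cd dd).
have dI : c0 <= d <= d0 by rewrite (le_trans cc cd) dd.
rewrite (segint_cat am mb (cont_on_sub aa bb (cont_on_horizontal cI))).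
rewrite (segint_cat am mb (cont_on_sub aa bb (cont_on_horizontal dI))).
lra.
Qed.

Lemma circulation_split_y a b c m d : a0 <= a -> a <= b -> b <= b0 ->
  c0 <= c -> c <= m -> m <= d -> d <= d0 ->
  circulation a b c d = circulation a b c m + circulation a b m d.
Proof.
move=> aa ab bb cc cm md dd; rewrite /circulation.
have aI : a0 <= a <= b0 by rewrite aa (le_trans ab bb).
have bI : a0 <= b <= b0 by rewrite (le_trans aa ab) bb.
rewrite (segint_cat cm md (cont_on_sub cc dd (cont_on_vertical aI))).
rewrite (segint_cat cm md (cont_on_sub cc dd (cont_on_vertical bI))).
lra.
Qed.

Lemma circulation_quarter a c w h : 0 <= w -> 0 <= h ->
  a0 <= a -> a + 2 * w <= b0 -> c0 <= c -> c + 2 * h <= d0 ->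
  exists a' c', [/\ a <= a' <= a + w, c <= c' <= c + h &
    `|circulation a (a + 2 * w) c (c + 2 * h)| <=
    4 * `|circulation a' (a' + w) c' (c' + h)|].
Proof.
move=> w0 h0 aa bb cc dd.
have sx : circulation a (a + 2 * w) c (c + 2 * h) =
    circulation a (a + w) c (c + 2 * h) + circulation (a + w) (a + w + w) c (c + 2 * h).
  have -> : a + w + w = a + 2 * w by ring.
  by apply: circulation_split_x; lra.
have sy a' : a0 <= a' -> a' + w <= b0 -> circulation a' (a' + w) c (c + 2 * h) =
    circulation a' (a' + w) c (c + h) + circulation a' (a' + w) (c + h) (c + h + h).
  move=> aa' ab'; have -> : c + h + h = c + 2 * h by ring.
  by apply: circulation_split_y; lra.
rewrite sx !sy; try lra.
have aw : a <= a <= a + w /\ a <= a + w <= a + w by rewrite !lexx lerDl w0.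
have ch : c <= c <= c + h /\ c <= c + h <= c + h by rewrite !lexx lerDl h0.
have [le|le|le|le] := norm_sum4_le (circulation a (a + w) c (c + h))
  (circulation a (a + w) (c + h) (c + h + h))
  (circulation (a + w) (a + w + w) c (c + h))
  (circulation (a + w) (a + w + w) (c + h) (c + h + h)).
- by exists a, c; split => //; [exact: aw.1|exact: ch.1].
- by exists a, (c + h); split => //; [exact: aw.1|exact: ch.2].
- by exists (a + w), c; split => //; [exact: aw.2|exact: ch.1].
- by exists (a + w), (c + h); split => //; [exact: aw.2|exact: ch.2].
Qed.

Let w n := (b0 - a0) / 2 ^+ n.
Let h n := (d0 - c0) / 2 ^+ n.

(** The corner z of a rectangle of the n-th generation that still carries its
    share of the circulation. *)
Let good n (z : R * R) := [/\ a0 <= z.1, z.1 + w n <= b0, c0 <= z.2, z.2 + h n <= d0 &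
  `|circulation a0 b0 c0 d0| <= 4 ^+ n * `|circulation z.1 (z.1 + w n) z.2 (z.2 + h n)|].

Let w_ge0 n : 0 <= w n.
Proof. by rewrite divr_ge0 ?exprn_ge0 // subr_ge0. Qed.

Let h_ge0 n : 0 <= h n.
Proof. by rewrite divr_ge0 ?exprn_ge0 // subr_ge0. Qed.

Let wS n : w n = 2 * w n.+1.
Proof. by rewrite /w exprS invfM; field; rewrite expf_neq0 // pnatr_eq0. Qed.

Let hS n : h n = 2 * h n.+1.
Proof. by rewrite /h exprS invfM; field; rewrite expf_neq0 // pnatr_eq0. Qed.

Lemma nested_rectangles : exists u : nat -> R * R, forall n,
  [/\ good n (u n), (u n).1 <= (u n.+1).1 <= (u n).1 + w n.+1 &
      (u n).2 <= (u n.+1).2 <= (u n).2 + h n.+1].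
Proof.
have step (nz : nat * (R * R)) : exists z', good nz.1 nz.2 ->
   [/\ good nz.1.+1 z', nz.2.1 <= z'.1 <= nz.2.1 + w nz.1.+1 &
      nz.2.2 <= z'.2 <= nz.2.2 + h nz.1.+1].
  case: nz => n [a c]; have [|ng] := pselect (good n (a, c)); last by exists (0, 0).
  rewrite /good /= wS hS => -[aa bb cc dd le].
  have [a' [c' [/andP[a1 a2] /andP[c1 c2] le']]] :=
    circulation_quarter (w_ge0 n.+1) (h_ge0 n.+1) aa bb cc dd.
  exists (a', c') => _ /=; split; [split => /=; try lra|exact/andP|exact/andP].
  rewrite exprSr -mulrA; apply: le_trans le _.
  by rewrite ler_pM2l // exprn_gt0.
have [f Hf] := choice step.
pose u := fix u n := if n is k.+1 then f (k, u k) else (a0, c0).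
have gu n : good n (u n).
  elim: n => [|n /(Hf (n, _))[]//].
  by rewrite /good /w /h !expr0 !divr1 mul1r /= !subrKC; split.
by exists u => n; have [? ? ?] := Hf (n, u n) (gu n).
Qed.

Lemma nested_point (s v : nat -> R) :
  (forall n, v n = 2 * v n.+1) -> (forall n, 0 <= v n) ->
  (forall n, s n <= s n.+1 <= s n + v n.+1) ->
  exists x, forall n, s n <= x <= s n + v n.
Proof.
move=> vS v0 sS.
have inc n k : s n <= s (n + k)%N.
  elim: k => [|k /le_trans->//]; first by rewrite addn0.
  by rewrite addnS; case/andP: (sS (n + k)%N).
have dec n k : s (n + k)%N + v (n + k)%N <= s n + v n.
  elim: k => [|k]; first by rewrite addn0.
  apply: le_trans; rewrite addnS (vS (n + k)%N).
  by case/andP: (sS (n + k)%N); lra.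
have ub n m : s m <= s n + v n.
  have [nm|mn] := leqP n m.
    apply: le_trans (dec n (m - n)%N); rewrite subnKC // lerDl.
    exact: v0.
  apply: le_trans (inc m (n - m)%N) _.
  by rewrite subnKC ?(ltnW mn) // lerDl.
exists (sup (range s)) => n; apply/andP; split.
  by apply: ub_le_sup; [exists (s 0%N + v 0%N) => _ [m _ <-]|exists n].
by apply: ge_sup; [exists (s 0%N), 0%N|move=> _ [m _ <-]].
Qed.

(** Goursat's quadrisection: a fixed fraction of the circulation would survive
    in nested rectangles of size 2^-n, at the scale 4^-n, against
    [circulation_small] at their common point. *)
Theorem goursat : circulation a0 b0 c0 d0 = 0.
Proof.
have [u Hu] := nested_rectangles.
have [x0 Hx] := @nested_point (fun n => (u n).1) w wS w_ge0
  (fun n => let: And3 _ a _ := Hu n in a).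
have [y0 Hy] := @nested_point (fun n => (u n).2) h hS h_ge0
  (fun n => let: And3 _ _ a := Hu n in a).
have xI : a0 <= x0 <= b0.
  by have := Hx 0%N; have [[]] := Hu 0%N; lra.
have yI : c0 <= y0 <= d0.
  by have := Hy 0%N; have [[]] := Hu 0%N; lra.
set K := (b0 - a0 + (d0 - c0)) ^+ 2.
have small e : 0 < e -> `|circulation a0 b0 c0 d0| <= e * K.
  move=> e0; have [dl dl0 H] := circulation_small xI yI e0.
  have [n [nw nh]] : exists n, w n <= dl /\ h n <= dl.
    set W := (b0 - a0 + (d0 - c0)) / dl.
    have W0 : 0 <= W by rewrite divr_ge0 ?(ltW dl0) // addr_ge0 // subr_ge0.
    exists (Num.bound W).
    have : W <= 2 ^+ Num.bound W.
      apply: le_trans (ltW (archi_boundP W0)) _.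
      by rewrite -natrX ler_nat ltnW // ltn_expl.
    rewrite ler_pdivrMr // => le.
    by split; rewrite ler_pdivrMr ?exprn_gt0 // mulrC; lra.
  have [[aa bb cc dd le] _ _] := Hu n.
  apply: le_trans le _.
  have le2 := H _ _ _ _ aa bb cc dd (Hx n) (Hy n).
  rewrite -ler_pdivlMl ?exprn_gt0 //; apply: le_trans (le2 _ _) _; try lra.
  rewrite /K /w /h.
  have e4 : 4 ^+ n = (2 ^+ n) ^+ 2 :> R by rewrite -exprM mulnC exprM expr2 -natrM.
  rewrite e4 le_eqVlt; apply/orP; left; apply/eqP; field.
  by rewrite expf_neq0 // pnatr_eq0.
apply/normr0_eq0/le_anti; rewrite normr_ge0 andbT.
apply/ler_addgt0Pr => e e0; rewrite add0r.
have K0 : 0 <= K by exact: sqr_ge0.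
apply: le_trans (small (e / (1 + K)) _) _; first by rewrite divr_gt0 // ltr_pwDl.
rewrite -mulrA ler_piMr ?(ltW e0) // ler_pdivrMl ?ltr_pwDl // mulr1 lerDr.
by rewrite ler01.
Qed.

End Goursat.

(** * The Schwarz inequality in the unit disc *)

Section ComplexDerivative.
Context {R : realType}.
Local Notation C := (R[i]^o).
Implicit Types (f g : C -> C) (z w D : C).

(** Complex derivative with real radii and errors: norms in [R[i]] are complex
    numbers, for which only a partial order is available. *)
Definition has_cderiv f z D := forall e : R, 0 < e -> exists2 d : R, 0 < d & forall w,
  normc (w - z) <= d -> normc (f w - f z - D * (w - z)) <= e * normc (w - z).

Lemma normc_le_ReIm z : normc z <= `|complex.Re z| + `|complex.Im z|.
Proof.
case: z => a b /=; rewrite -[leRHS]ger0_norm ?addr_ge0 // -sqrtr_sqr.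
apply: ler_wsqrtr; rewrite sqrrD !real_normK ?num_real //.
by rewrite lerD2r lerDl mulrn_wge0 // mulr_ge0.
Qed.

Lemma normc_ge_Re z : `|complex.Re z| <= normc z.
Proof. by case: z => a b /=; rewrite -sqrtr_sqr; apply: ler_wsqrtr; rewrite lerDl sqr_ge0. Qed.

Lemma normc_ge_Im z : `|complex.Im z| <= normc z.
Proof. by case: z => a b /=; rewrite -sqrtr_sqr; apply: ler_wsqrtr; rewrite lerDr sqr_ge0. Qed.

Lemma normc_ge0 z : 0 <= normc z.
Proof. by case: z => a b /=; exact: sqrtr_ge0. Qed.

Lemma ball_normc z w (e : R) : ball z e%:C w <-> normc (z - w) < e.
Proof. by rewrite -ball_normE /= -ltcR. Qed.

Lemma pos_realE (e : C) : 0 < e -> e = (complex.Re e)%:C /\ 0 < complex.Re e.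
Proof. by case: e => a b; rewrite ltcE /= => /andP[/eqP -> ?]. Qed.

Lemma nbhs_normcP z (A : set C) :
  nbhs z A <-> exists2 d : R, 0 < d & forall w, normc (w - z) < d -> A w.
Proof.
split => [/nbhs_ballP[e /pos_realE[-> e0] eA]|[d d0 dA]].
  exists (complex.Re e) => // w wz; apply: eA; apply/ball_normc.
  by rewrite -normcN opprB.
apply/nbhs_ballP; exists d%:C; first by rewrite /= ltcR.
by move=> w /ball_normc zw; apply: dA; rewrite -normcN opprB.
Qed.

Lemma is_derive_cderivP f z D : is_derive z (1 : C) f D <-> has_cderiv f z D.
Proof.
have cvgP : is_derive z (1 : C) f D <->
    h^-1 *: (f (h *: (1 : C) + z) - f z) @[h --> (0 : C)^'] --> D.
  split=> [[df <-]|df]; first exact: df.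
  by split; [apply/cvg_ex; exists D|exact: cvg_lim].
rewrite cvgP; split => [/cvgrPdist_le H e e0|H].
  have : (0 : C) < e%:C by rewrite ltcR.
  move=> /H /nbhs_normcP [d d0 Hd].
  exists (d / 2) => [|w wz]; first by rewrite divr_gt0.
  have [->|wz0] := eqVneq w z.
    by rewrite !subrr mulr0 subrr normc0 mulr0.
  have wd : normc (w - z - 0) < d by rewrite subr0; apply: le_lt_trans wz _; lra.
  have wz1 : w - z != 0 by rewrite subr_eq0.
  have := Hd (w - z) wd wz1.
  rewrite [_ *: 1]mulr1 subrK => le1.
  have : normc (D - (w - z)^-1 *: (f w - f z)) <= e by rewrite -lecR; exact: le1.
  move=> le2; have wzn : w - z != 0 by rewrite subr_eq0.
  have -> : f w - f z - D * (w - z) = - ((D - (w - z)^-1 *: (f w - f z)) * (w - z)).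
    by rewrite mulrBl [_ *: _]mulrC mulfVK // opprB.
  by rewrite normcN normcM ler_wpM2r // normc_ge0.
apply/cvgrPdist_le => e /pos_realE[-> e0].
have [d d0 Hd] := H _ e0.
apply/nbhs_normcP; exists d => // w; rewrite subr0 => wd w0.
have := Hd (w + z); rewrite addrK => /(_ (ltW wd)) le1.
rewrite [w *: 1]mulr1 lecR.
have wn : 0 < normc w.
  rewrite lt_neqAle normc_ge0 andbT.
  by rewrite eq_sym; apply: contra_neq w0; exact: eq0_normc.
have -> : D - w^-1 *: (f (w + z) - f z) = - ((f (w + z) - f z - D * w) / w).
  by rewrite mulrBl mulfK // opprB [_ *: _]mulrC.
by rewrite normcN normcM normcV ler_pdivrMr.
Qed.

End ComplexDerivative.

Section RealSlope.
Context {R : realType}.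

Lemma is_derive_slope (f : R -> R) (x l e : R) : is_derive x 1 f l -> 0 < e ->
  exists2 d, 0 < d & forall w, `|w| <= d -> `|f (w + x) - f x - l * w| <= e * `|w|.
Proof.
move=> [df fl] e0.
have H : h^-1 *: (f (h *: 1 + x) - f x) @[h --> 0^'] --> l by rewrite -fl; exact: df.
move/cvgrPdist_le : H => /(_ _ e0) /nbhs_ballP[d /= d0 Hd].
exists (d / 2) => [|w wd]; first exact: divr_gt0.
have [->|w0] := eqVneq w 0.
  by rewrite add0r subrr mulr0 subr0 !normr0 mulr0.
have b : ball 0 d w.
  by rewrite -ball_normE /= sub0r normrN; apply: le_lt_trans wd _; lra.
have := Hd w b w0; rewrite [w *: 1]mulr1 => le1.
have -> : f (w + x) - f x - l * w = - ((l - w^-1 *: (f (w + x) - f x)) * w).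
  by rewrite mulrBl [_ *: _]mulrC mulfVK // opprB.
by rewrite normrN normrM ler_wpM2r.
Qed.

End RealSlope.

Section ComplexExp.
Context {R : realType}.
Local Notation C := (R[i]^o).

Definition cexp (z : C) : C :=
  (expR (complex.Re z) * cos (complex.Im z)) +i* (expR (complex.Re z) * sin (complex.Im z)).

Lemma cexpD z w : cexp (z + w) = cexp z * cexp w.
Proof.
case: z w => [a b] [c d]; rewrite /cexp /= expRD cosD sinD.
by apply/eqP; rewrite eq_complex /=; apply/andP; split; apply/eqP; ring.
Qed.

Lemma normc_cexp z : normc (cexp z) = expR (complex.Re z).
Proof.
rewrite /= !exprMn -mulrDr cos2Dsin2 mulr1 sqrtr_sqr ger0_norm // expR_ge0.
Qed.

Lemma cexp_neq0 z : cexp z != 0.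
Proof.
apply/eqP => E; have := normc_cexp z; rewrite E normc0 => /esym/eqP.
by rewrite gt_eqF // expR_gt0.
Qed.

(** The remainder of the exponential at 0 splits along the first-order remainders
    of exp, sin and cos, plus products of two small quantities; the constant 7
    is the sum of the coefficients in their bounds. *)
Lemma cexp_has_cderiv0 : has_cderiv cexp 0 1.
Proof.
move=> e e0; have [t [t0 t1 te]] : exists t : R, [/\ 0 < t, t <= 1 & t <= e / 7].
  exists (Num.min 1 (e / 7)); split; last 2 first.
  - by rewrite ge_min lexx.
  - by rewrite ge_min lexx orbT.
  - by rewrite lt_min ltr01 divr_gt0.
have [d1 d10 H1] := is_derive_slope (is_derive_expR (0 : R)) t0.
have [d2 d20 H2] := is_derive_slope (is_derive_sin (0 : R)) t0.
have [d3 d30 H3] := is_derive_slope (is_derive_cos (0 : R)) t0.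
exists (Num.min t (Num.min d1 (Num.min d2 d3))); first by rewrite lt_min t0 lt_min d10 lt_min d20.
move=> w; rewrite subr0 le_min le_min le_min => /and4P[wt wd1 wd2 wd3].
move: (normc_ge_Re w) (normc_ge_Im w) (normc_ge0 w) wt wd1 wd2 wd3.
have -> : cexp w - cexp 0 - 1 * w =
   (expR (complex.Re w) * cos (complex.Im w) - 1 - complex.Re w) +i*
   (expR (complex.Re w) * sin (complex.Im w) - complex.Im w).
  case: w => a b; rewrite /cexp /= expR0 cos0 sin0 mul1r mulr0; simpc.
  by congr (_ +i* _); rewrite mulr1.
set N := normc w; set a := complex.Re w; set b := complex.Im w.
move=> aN bN N0 Nt Nd1 Nd2 Nd3.
have := H1 a (le_trans aN Nd1); have := H2 b (le_trans bN Nd2).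
have := H3 b (le_trans bN Nd3).
rewrite !addr0 expR0 cos0 sin0 !oppr0 mul0r !addr0 !subr0 !mul1r.
have ta : t * `|a| <= t * N by rewrite ler_pM2l.
have tb : t * `|b| <= t * N by rewrite ler_pM2l.
move=> /le_trans /(_ tb) hc /le_trans /(_ tb) hs /le_trans /(_ ta) he.
have hs' : `|sin b| <= 2 * N.
  rewrite -[sin b](subrK b); apply: le_trans (ler_normD _ _) _.
  have tN : t * N <= N by rewrite ler_piMl.
  have := lerD hs bN; lra.
have cos1 : `|cos b| <= 1 by rewrite ler_norml cos_geN1 cos_le1.
have sin1 : `|sin b| <= 1 by rewrite ler_norml sin_geN1 sin_le1.
have N1 : N <= 1 by apply: le_trans Nt t1.
apply: le_trans (normc_le_ReIm _) _ => /=.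
have -> : expR a * cos b - 1 - a = (expR a - 1 - a) * cos b + (1 + a) * (cos b - 1) by ring.
have -> : expR a * sin b - b = (expR a - 1 - a) * sin b + a * sin b + (sin b - b) by ring.
have b1 : `|(expR a - 1 - a) * cos b| <= t * N.
  by rewrite normrM; apply: le_trans he; rewrite ler_piMr.
have b2 : `|(1 + a) * (cos b - 1)| <= 2 * (t * N).
  rewrite normrM; apply: ler_pM => //; apply: le_trans (ler_normD _ _) _.
  by rewrite normr1; lra.
have b3 : `|(expR a - 1 - a) * sin b| <= t * N.
  by rewrite normrM; apply: le_trans he; rewrite ler_piMr.
have b4 : `|a * sin b| <= 2 * (t * N).
  by rewrite normrM mulrC mulrA; apply: ler_pM => //; apply: le_trans hs' _; lra.
have := ler_normD ((expR a - 1 - a) * cos b) ((1 + a) * (cos b - 1)).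
have := ler_normD ((expR a - 1 - a) * sin b + a * sin b) (sin b - b).
have := ler_normD ((expR a - 1 - a) * sin b) (a * sin b).
have eN : t * N <= e / 7 * N by rewrite ler_wpM2r.
lra.
Qed.

End ComplexExp.

Section Schwarz.
Context {R : realType}.
Local Notation C := (R[i]^o).

Lemma cexp_has_cderiv (z : C) : has_cderiv cexp z (cexp z).
Proof.
move=> e e0; have c0 : 0 < normc (cexp z) by rewrite normc_cexp expR_gt0.
have [d d0 H] := cexp_has_cderiv0 (divr_gt0 e0 c0).
exists d => // w wz; have := H (w - z); rewrite subr0 mul1r => /(_ wz).
have Ew : cexp w = cexp z * cexp (w - z) by rewrite -cexpD addrC subrK.
have -> : cexp w - cexp z - cexp z * (w - z) =
    cexp z * (cexp (w - z) - cexp 0 - (w - z)).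
  rewrite Ew.
  have -> : cexp 0 = 1 :> C.
    by apply/eqP; rewrite /cexp eq_complex /= expR0 cos0 sin0 mulr1 mulr0 !eqxx.
  by rewrite !mulrBr mulr1.
rewrite normcM => le1; apply: le_trans (ler_wpM2l (normc_ge0 _) le1) _.
by rewrite mulrA mulrCA divff ?mulr1 // gt_eqF.
Qed.

(** The Cauchy-Riemann equations: the imaginary part of k dz is the form
    Im k dx + Re k dy, and it is closed wherever k has a complex derivative. *)
Lemma has_cderiv_closed_form (k : C -> C) (D : C) (x0 y0 : R) :
  has_cderiv k (x0 +i* y0) D ->
  closed_form_at (fun x y => complex.Im (k (x +i* y)))
                 (fun x y => complex.Re (k (x +i* y))) x0 y0.
Proof.
move=> kD; exists (complex.Im D), (complex.Re D), (- complex.Im D) => e e0.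
have [d d0 H] := kD e e0.
exists (d / 2) => [|x y xd yd]; first exact: divr_gt0.
have le1 : normc ((x +i* y) - (x0 +i* y0) : C) <= `|x - x0| + `|y - y0|.
  by apply: le_trans (normc_le_ReIm _) _; rewrite /= lexx.
have le2 := H (x +i* y) (le_trans le1 _).
have /le2 {}le2 : `|x - x0| + `|y - y0| <= d by have := lerD xd yd; lra.
have {}le2 := le_trans le2 (ler_wpM2l (ltW e0) le1).
split.
  apply: le_trans le2; apply: le_trans (normc_ge_Im _).
  case: (k _) (k _) D {kD H} => [u v] [u' v'] [p q] /=.
  by rewrite le_eqVlt; apply/orP; left; apply/eqP; congr (`| _ |); ring.
apply: le_trans le2; apply: le_trans (normc_ge_Re _).
case: (k _) (k _) D {kD H} => [u v] [u' v'] [p q] /=.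
by rewrite le_eqVlt; apply/orP; left; apply/eqP; congr (`| _ |); ring.
Qed.

Lemma cexp_periodic (x y : R) : cexp (x +i* (y + pi *+ 2)) = cexp (x +i* y) :> C.
Proof. by rewrite /cexp /= cosD2pi sinD2pi. Qed.

(** When k is a function of exp z, the two horizontal sides of a rectangle of
    height 2 pi cancel; the vertical sides are means over concentric circles. *)
Lemma circle_mean (k : C -> C) (x1 x2 : R) : x1 <= x2 ->
  (forall z : C, complex.Re z <= x2 -> exists D, has_cderiv k z D) ->
  (forall x, k (x +i* 0) = k (x +i* (pi *+ 2))) ->
  segint 0 (pi *+ 2) (fun y => complex.Re (k (x1 +i* y))) =
  segint 0 (pi *+ 2) (fun y => complex.Re (k (x2 +i* y))).
Proof.
move=> x12 kD kper.
have p0 : 0 <= pi *+ 2 :> R by rewrite mulrn_wge0 // pi_ge0.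
have := @goursat _ (fun x y => complex.Im (k (x +i* y)))
  (fun x y => complex.Re (k (x +i* y))) x1 x2 0 (pi *+ 2) x12 p0.
rewrite /circulation => circ0.
have closed x y : x1 <= x <= x2 -> 0 <= y <= pi *+ 2 ->
    closed_form_at (fun x y => complex.Im (k (x +i* y)))
      (fun x y => complex.Re (k (x +i* y))) x y.
  move=> /andP[_ xx2] _; have [D kD'] := kD (x +i* y) xx2.
  exact: has_cderiv_closed_form kD'.
move/(_ closed): circ0.
have -> : (fun x => complex.Im (k (x +i* 0))) = (fun x => complex.Im (k (x +i* (pi *+ 2)))).
  by apply/funext => x; rewrite kper.
by rewrite subrr add0r => /eqP; rewrite subr_eq0 => /eqP ->.
Qed.

(** Schwarz's lemma at the origin, with a bound M.  The function
    h (exp z) / exp z has the same mean over all the circles: near -oo it tends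
    to D, while on the circle of radius rho it is at most M / rho.  The factor c
    rotates D onto the positive axis, so that real parts suffice. *)
Theorem schwarz (h : C -> C) (D : C) (M : R) :
  (forall z : C, normc z < 1 -> differentiable h z) ->
  (forall z : C, normc z < 1 -> normc (h z) <= M) ->
  h 0 = 0 -> has_cderiv h 0 D -> normc D <= M.
Proof.
move=> hd hM h0 hD; rewrite leNgt; apply/negP => MD.
have M0 : 0 <= M by apply: le_trans (hM 0 _); [exact: normc_ge0|rewrite normc0 ltr01].
set nD := normc D in MD.
have nD0 : 0 < nD by apply: le_lt_trans MD.
have Dn0 : D != 0 by apply/eqP => E; rewrite /nD E normc0 ltxx in nD0.
pose c : C := (nD%:C) / D.
have nc : normc c = 1.
  rewrite /c normcM normcV -/nD /= expr0n addr0 sqrtr_sqr ger0_norm ?(ltW nD0) //.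
  by rewrite divff // gt_eqF.
have cD : c * D = nD%:C by rewrite /c divfK.
pose k (z : C) : C := c * (h (cexp z) / cexp z).
have disc (z : C) : complex.Re z < 0 -> normc (cexp z) < 1.
  by move=> z0; rewrite normc_cexp -expR0 ltr_expR.
have kder (z : C) : complex.Re z < 0 -> exists D', has_cderiv k z D'.
  move=> z0.
  have dE : differentiable cexp z.
    by apply/derivable1_diffP; have /is_derive_cderivP[] := @cexp_has_cderiv z.
  have dh : differentiable (h \o cexp) z.
    exact: (differentiable_comp dE (hd _ (disc _ z0))).
  have dV : differentiable (fun w => (cexp w)^-1 : C) z.
    by apply: differentiableV => //; exact: cexp_neq0.
  have dk : differentiable k z.
    have dc : differentiable (cst c : C -> C) z by exact: differentiable_cst.
    exact: (differentiableM dc (differentiableM dh dV)).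
  move/derivable1_diffP : dk => /derivableP dk.
  by eexists; apply/is_derive_cderivP; exact: dk.
pose Mean x := segint 0 (pi *+ 2) (fun y => complex.Re (k (x +i* y))).
have mean_cst x1 x2 : x1 <= x2 -> x2 < 0 -> Mean x1 = Mean x2.
  move=> x12 x20; apply: circle_mean => // [z zx|x].
    by apply: kder; apply: le_lt_trans zx x20.
  by rewrite /k -[pi *+ 2]add0r cexp_periodic.
have p0 : 0 < pi *+ 2 :> R by rewrite mulrn_wgt0 // pi_gt0.
have mean_cont x : x < 0 ->
    cont_on (fun y => complex.Re (k (x +i* y))) 0 (pi *+ 2).
  move=> x0.
  have cl x' y : x <= x' <= x -> 0 <= y <= pi *+ 2 ->
      closed_form_at (fun x y => complex.Im (k (x +i* y)))
        (fun x y => complex.Re (k (x +i* y))) x' y.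
    rewrite -eq_le => /eqP <- _; have [D' H] := kder (x +i* y) x0.
    exact: has_cderiv_closed_form H.
  have := cont_on_vertical cl; apply; by rewrite lexx.
have small_circle e : 0 < e -> exists x1, forall x, x <= x1 -> x < 0 ->
    `|Mean x - nD * (pi *+ 2 - 0)| <= e * (pi *+ 2 - 0).
  move=> e0; have [d d0 H] := hD _ e0.
  exists (ln d) => x xd x0; apply: segint_near_cst; first exact: ltW.
    exact: mean_cont.
  move=> y _; have Ed : normc (cexp (x +i* y) - 0) <= d.
    by rewrite subr0 normc_cexp /= -[leRHS]lnK // ler_expR.
  have := H _ Ed; rewrite h0 !subr0.
  set E := cexp (x +i* y) => le1.
  have -> : complex.Re (k (x +i* y)) - nD = complex.Re (k (x +i* y) - nD%:C).
    by case: (k _).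
  apply: le_trans (normc_ge_Re _) _.
  have -> : k (x +i* y) - nD%:C = c * ((h E - D * E) / E).
    rewrite -cD /k -/E -mulrBr; congr (_ * _).
    by rewrite mulrBl mulfK // cexp_neq0.
  rewrite normcM nc mul1r normcM normcV ler_pdivrMr //.
  by rewrite normc_cexp expR_gt0.
have big_circle x : x < 0 -> `|Mean x| <= M / expR x * (pi *+ 2 - 0).
  move=> x0; have := @segint_near_cst _ (fun y => complex.Re (k (x +i* y))) 0 (pi *+ 2) 0 (M / expR x).
  rewrite mul0r subr0; apply; first exact: ltW.
    exact: mean_cont.
  move=> y _; rewrite subr0; apply: le_trans (normc_ge_Re _) _.
  rewrite /k normcM nc mul1r normcM normcV normc_cexp /=.
  by rewrite ler_wpM2r ?invr_ge0 ?expR_ge0 //; apply: hM; exact: disc.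
(* If M < |D|, take m halfway between and a radius rho with M / rho < m. *)
pose m := (nD + M) / 2.
have m0 : 0 < m by rewrite /m; lra.
pose rho := (1 + M / m) / 2.
have Mm : M / m < 1 by rewrite ltr_pdivrMr // /m; lra.
have Mm0 : 0 <= M / m by rewrite divr_ge0 // ltW.
have rho0 : 0 < rho by rewrite /rho; lra.
have rho1 : rho < 1 by rewrite /rho; lra.
have x20 : ln rho < 0 by apply: ln_lt0; rewrite rho0 rho1.
have e0 : 0 < nD - m by rewrite /m; lra.
have [x1 Hx1] := small_circle _ e0.
pose x := Num.min x1 (ln rho).
have xx1 : x <= x1 by rewrite ge_min lexx.
have xx2 : x <= ln rho by rewrite ge_min lexx orbT.
have /ler_normlP[le1 _] := Hx1 _ xx1 (le_lt_trans xx2 x20).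
have /ler_normlP[_ le2] := big_circle _ x20.
move: le1 le2; rewrite (mean_cst _ _ xx2 x20) lnK // subr0.
move=> le1 le2.
have Mr : M / rho < m.
  have -> : M / rho = M * 2 / (1 + M / m) by rewrite /rho invf_div mulrA.
  rewrite ltr_pdivrMr; last by lra.
  have Em : m * (M / m) = M by rewrite mulrC divfK ?gt_eqF.
  by rewrite [m * _]mulrDr mulr1 Em /m; lra.
have : M / rho * (pi *+ 2) < m * (pi *+ 2) by rewrite ltr_pM2r.
lra.
Qed.

End Schwarz.

(** * Differentiability of matrix-valued maps *)

Section MatrixDifferential.
Context {K : numFieldType}.

Lemma mx_linear_differentiable m n (W : normedModType K)
  (L : {linear 'M[K]_(m, n) -> W}) M : differentiable L M.
Proof.
have -> : (L : 'M[K]_(m, n) -> W) =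
    \sum_(p < m) \sum_(q < n) (fun N : 'M[K]_(m, n) => N p q *: L (delta_mx p q)).
  apply/funext => N; rewrite fct_sumE {1}[N]matrix_sum_delta linear_sum.
  by apply: eq_bigr => p _; rewrite fct_sumE linear_sum; apply: eq_bigr => q _; rewrite linearZ.
apply: differentiable_sum => p; apply: differentiable_sum => q.
apply: (@differentiableZl _ _ _ (fun N : 'M[K]_(m, n) => N p q : K)).
exact: differentiable_coord.
Qed.

Lemma diff_mx_linear m n (W : normedModType K)
  (L : {linear 'M[K]_(m, n) -> W}) M : 'd L M = L :> ('M[K]_(m, n) -> W).
Proof.
by apply: diff_lin => N; apply: differentiable_continuous; exact: mx_linear_differentiable.
Qed.

Lemma differentiable_entries m n (V : normedModType K) (f : V -> 'M[K]_(m, n)) x :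
  (forall p q, differentiable (fun y => f y p q : K) x) -> differentiable f x.
Proof.
move=> df.
have -> : f = \sum_(p < m) \sum_(q < n) (fun y : V => f y p q *: (delta_mx p q : 'M[K]_(m, n))).
  apply/funext => y; rewrite fct_sumE {1}[f y]matrix_sum_delta.
  by apply: eq_bigr => p _; rewrite fct_sumE.
apply: differentiable_sum => p; apply: differentiable_sum => q.
by apply: (@differentiableZl _ _ _ (fun y => f y p q : K)).
Qed.

Lemma differentiable_entry m n (V : normedModType K) (f : V -> 'M[K]_(m, n)) x p q :
  differentiable f x -> differentiable (fun y => f y p q : K) x.
Proof.
move=> df.
apply: (@differentiable_comp _ _ _ _ f (fun N : 'M[K]_(m, n) => N p q : K)) => //.
exact: differentiable_coord.
Qed.

Lemma differentiable_prod (I : Type) (r : seq I) (V : normedModType K) (f : I -> V -> K) x :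
  (forall i, differentiable (f i) x) ->
  differentiable (fun y => \prod_(i <- r) f i y) x.
Proof.
move=> df; elim: r => [|i r IH].
  have -> : (fun y => \prod_(i <- [::]) f i y) = cst 1 by apply/funext => y; rewrite big_nil.
  exact: differentiable_cst.
have -> : (fun y => \prod_(j <- i :: r) f j y) = f i * (fun y => \prod_(j <- r) f j y).
  by apply/funext => y; rewrite big_cons.
exact: differentiableM.
Qed.

Lemma differentiable_bigsum (I : Type) (r : seq I) (V W : normedModType K) (f : I -> V -> W) x :
  (forall i, differentiable (f i) x) ->
  differentiable (fun y => \sum_(i <- r) f i y) x.
Proof.
move=> df; elim: r => [|i r IH].
  have -> : (fun y => \sum_(i <- [::]) f i y) = cst 0 by apply/funext => y; rewrite big_nil.
  exact: differentiable_cst.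
have -> : (fun y => \sum_(j <- i :: r) f j y) = f i + (fun y => \sum_(j <- r) f j y).
  by apply/funext => y; rewrite big_cons.
exact: differentiableD.
Qed.

Lemma differentiable_det n (V : normedModType K) (f : V -> 'M[K]_n) x :
  differentiable f x -> differentiable (fun y => \det (f y) : K) x.
Proof.
move=> df; rewrite /determinant; apply: differentiable_bigsum => s.
apply: (@differentiableM _ _ (cst _)) => //.
by apply: differentiable_prod => i; exact: differentiable_entry.
Qed.

Lemma differentiable_adj n (V : normedModType K) (f : V -> 'M[K]_n) x :
  differentiable f x -> differentiable (fun y => \adj (f y)) x.
Proof.
move=> df; apply: differentiable_entries => p q.
have -> : (fun y => (\adj (f y)) p q : K) = cst ((-1) ^+ (q + p)) *
   (fun y => \det (row' q (col' p (f y)))).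
  by apply/funext => y; rewrite mxE.
apply: differentiableM => //; apply: differentiable_det.
apply: differentiable_entries => a b.
have -> : (fun y => row' q (col' p (f y)) a b : K) = (fun y => f y (lift q a) (lift p b)).
  by apply/funext => y; rewrite !mxE.
exact: differentiable_entry.
Qed.

Lemma differentiable_mulmx m n k (V : normedModType K)
    (f : V -> 'M[K]_(m, n)) (g : V -> 'M[K]_(n, k)) x :
  differentiable f x -> differentiable g x -> differentiable (fun y => f y *m g y) x.
Proof.
move=> df dg; apply: differentiable_entries => p q.
have -> : (fun y => (f y *m g y) p q : K) = (fun y => \sum_j (f y p j * g y j q)).
  by apply/funext => y; rewrite mxE.
apply: differentiable_bigsum => j.
by apply: (@differentiableM _ _ (fun y => f y p j) (fun y => g y j q));
  exact: differentiable_entry.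
Qed.

(** Cramer's formula for the inverse, without the case distinction of [invmx]:
    differentiable near an invertible matrix by the rules for entries alone. *)
Definition cramer_inv n (A : 'M[K]_n) : 'M[K]_n := (\det A)^-1 *: \adj A.

Lemma differentiable_cramer_inv n (V : normedModType K) (f : V -> 'M[K]_n) x :
  differentiable f x -> f x \in unitmx ->
  differentiable (fun y => cramer_inv (f y)) x.
Proof.
move=> df ux; apply: differentiable_entries => p q.
have -> : (fun y => cramer_inv (f y) p q : K) =
    (fun y => (\det (f y))^-1) * (fun y => (\adj (f y)) p q).
  by apply/funext => y; rewrite mxE.
apply: differentiableM; last by apply: differentiable_entry; exact: differentiable_adj.
apply: differentiableV; first exact: differentiable_det.
by rewrite unitmxE unitfE in ux.
Qed.

Lemma cramer_invE n (A : 'M[K]_n) : A \in unitmx -> cramer_inv A = invmx A.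
Proof. by move=> uA; rewrite /invmx uA. Qed.

End MatrixDifferential.

(** * Hermitian norm, operator norm and the domain *)

Section HermitianNorm.
Context {R : realType}.
Local Notation C := R[i].

(** Matrices with their normed module structure made explicit, which inference
    does not find from the entries in [R[i]]. *)
Definition Mat m n : normedModType C := 'M[C]_(m, n).

Definition sqnorm n (u : 'rV[C]_n) : R := complex.Re ((u *m u ^t*) 0 0).

Lemma sqnormE n (u : 'rV[C]_n) : (u *m u ^t*) 0 0 = (sqnorm u)%:C.
Proof.
rewrite /sqnorm RRe_real // -dotmxE; apply: ger0_real; exact: dnorm_ge0.
Qed.

Lemma sqnorm_ge0 n (u : 'rV[C]_n) : 0 <= sqnorm u.
Proof. by rewrite -lecR -sqnormE -dotmxE; exact: dnorm_ge0. Qed.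

Lemma sqnorm_gt0 n (u : 'rV[C]_n) : (0 < sqnorm u) = (u != 0).
Proof. by rewrite -ltcR -sqnormE -dotmxE dnorm_gt0. Qed.

Lemma sqnorm_le0 n (u : 'rV[C]_n) : sqnorm u <= 0 -> u = 0.
Proof. by move=> u0; apply/eqP; rewrite -[_ == _]negbK -sqnorm_gt0 -leNgt. Qed.

Lemma sqnorm0 n : sqnorm (0 : 'rV[C]_n) = 0.
Proof. by rewrite /sqnorm mul0mx mxE. Qed.

Lemma normc_sqr (z : C) : (normc z ^+ 2)%:C = z * z^*.
Proof. by rewrite rmorphXn /= -sqr_normc. Qed.

Lemma sqnormZ n (c : C) (u : 'rV[C]_n) : sqnorm (c *: u) = normc c ^+ 2 * sqnorm u.
Proof.
apply: complexI; rewrite -sqnormE rmorphM /= -sqnormE normc_sqr.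
by rewrite linearZ /= map_mxZ /= -scalemxAl -scalemxAr scalerA mxE.
Qed.

Lemma sqnorm_parallelogram n (u v : 'rV[C]_n) :
  sqnorm (u + v) + sqnorm (u - v) = 2 * (sqnorm u + sqnorm v).
Proof.
rewrite /sqnorm !linearD /= !linearN /= !map_mxD /= !map_mxN !mulmxDl !mulmxDr !mulmxN !mulNmx.
by rewrite !mxE /= !raddfD /= !raddfN /=; ring.
Qed.

Lemma sqnorm_row_mx n1 n2 (u : 'rV[C]_n1) (v : 'rV[C]_n2) :
  sqnorm (row_mx u v) = sqnorm u + sqnorm v.
Proof.
by apply: complexI; rewrite rmorphD /= -!sqnormE tr_row_mx map_col_mx mul_row_col mxE.
Qed.

Lemma cauchy_schwarz n (u v : 'rV[C]_n) :
  normc ((u *m v ^t*) 0 0) ^+ 2 <= sqnorm u * sqnorm v.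
Proof.
have : `|dotmx u v| ^+ 2 <= dotmx u u * dotmx v v.
  by have [le _] := CauchySchwarz (@dotmx _ n) u v; exact: le.
rewrite !dotmxE !sqnormE -lecR => le.
by rewrite rmorphXn [leRHS]rmorphM.
Qed.

Lemma trmxCM m n p (A : 'M[C]_(m, n)) (B : 'M[C]_(n, p)) :
  (A *m B) ^t* = B ^t* *m A ^t*.
Proof. by rewrite trmx_mul map_mxM. Qed.

Lemma Omega_IP r s (Z : 'M[C]_(r, s)) :
  Omega_I R r s Z <-> (forall u, u != 0 -> sqnorm (u *m Z) < sqnorm u).
Proof.
have E u : (u *m (1%:M - Z *m Z ^t*) *m u ^t*) 0 0 = (sqnorm u - sqnorm (u *m Z))%:C.
  rewrite rmorphB /= -!sqnormE trmxCM mulmxBr mulmx1 mulmxBl.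
  by rewrite !mulmxA [in LHS]mxE [X in _ + X]mxE.
split=> [[_ H] u u0|H]; first by rewrite -subr_gt0 -ltcR -E; exact: H.
split=> [|u u0]; last by rewrite E ltcR subr_gt0; exact: H.
by rewrite linearB /= map_mxB /= trmx1 map_mx1 trmxCM trmxCK.
Qed.

(** Bounds on the operator norm, which itself is never formed. *)
Definition opnorm_le m n (k : R) (M : 'M[C]_(m, n)) :=
  forall u, sqnorm (u *m M) <= k ^+ 2 * sqnorm u.

(** The bilinear form of the bound is symmetric under adjunction, and matches the
    scalar functions [u *m _ *m w^*] by which holomorphic maps are tested. *)
Lemma opnorm_leP m n (k : R) (M : 'M[C]_(m, n)) :
  opnorm_le k M <-> (forall u w,
    normc ((u *m M *m w ^t*) 0 0) ^+ 2 <= k ^+ 2 * (sqnorm u * sqnorm w)).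
Proof.
split=> H u.
  move=> w; apply: le_trans (cauchy_schwarz _ _) _.
  by rewrite mulrA ler_wpM2r ?sqnorm_ge0.
have := H u (u *m M); rewrite sqnormE /= expr0n addr0 sqrtr_sqr ger0_norm ?sqnorm_ge0 //.
have [|v0] := leP (sqnorm (u *m M)) 0; last by rewrite expr2 mulrA ler_pM2r.
by move=> le0 _; apply: le_trans le0 _; rewrite mulr_ge0 ?sqr_ge0 ?sqnorm_ge0.
Qed.

Lemma normc_conj (z : C) : normc z^* = normc z.
Proof. by apply: complexI; exact: normcJ. Qed.

Lemma opnorm_le_adj m n (k : R) (M : 'M[C]_(m, n)) : opnorm_le k M -> opnorm_le k (M ^t*).
Proof.
move=> /opnorm_leP H; apply/opnorm_leP => u w.
have -> : u *m M ^t* *m w ^t* = (w *m M *m u ^t*) ^t*.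
  by rewrite !trmxCM trmxCK mulmxA.
rewrite [(_ ^t*) _ _]mxE [(_^T) _ _]mxE normc_conj [sqnorm u * _]mulrC; exact: H.
Qed.

Lemma opnorm_le_Omega m n (M : 'M[C]_(m, n)) c :
  opnorm_le 1 M -> normc c < 1 -> Omega_I R m n (c *: M).
Proof.
move=> M1 c1; apply/Omega_IP => u u0; rewrite -scalemxAr sqnormZ.
have := M1 u; rewrite expr1n mul1r => le1.
apply: le_lt_trans (ler_wpM2l (sqr_ge0 _) le1) _.
by rewrite gtr_pMl ?sqnorm_gt0 // expr_lt1 // normc_ge0.
Qed.

Lemma Omega0 m n : Omega_I R m n 0.
Proof.
have : opnorm_le 1 (0 : 'M[C]_(m, n)).
  by move=> u; rewrite mulmx0 sqnorm0 expr1n mul1r sqnorm_ge0.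
move=> H0; have : normc (0 : C) < 1 by rewrite normc0.
by move=> /(opnorm_le_Omega H0); rewrite scaler0.
Qed.

Section SchwarzMatrix.
Variables (p q p' q' : nat) (G : 'M[C]_(p, q) -> 'M[C]_(p', q')).
Hypothesis holG : holomorphic_map (Omega_I R p q) (Omega_I R p' q') G.
Hypothesis G0 : G 0 = 0.

(** A holomorphic map fixing the origin maps the disc a M, |a| < 1, into the
    domain; Schwarz's inequality bounds every scalar test of the derivative. *)
Lemma schwarz_matrix M : opnorm_le 1 M -> opnorm_le 1 ('d G 0 M).
Proof.
move=> M1; apply/opnorm_leP => u w.
pose phi (N : 'M[C]_(p', q')) : C^o := (u *m N *m w ^t*) 0 0.
have phi_lin : linear phi.
  move=> a x y; rewrite /phi mulmxDr mulmxDl -scalemxAr -scalemxAl.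
  by rewrite mxE [X in X + _ = _]mxE.
pose phiM := GRing.isLinear.Build _ _ _ _ _ phi_lin.
pose phiL : {linear 'M[C]_(p', q') -> C^o} := HB.pack phi phiM.
pose sc (a : C^o) : 'M[C]_(p, q) := a *: M.
pose h : C^o -> C^o := phi \o (G \o sc).
have dsc a : is_diff a sc sc by exact: is_diff_scalel.
have dphi N : differentiable phi N by exact: (mx_linear_differentiable phiL).
have sc0 : sc 0 = 0 by rewrite /sc scale0r.
have dG (a : C^o) : normc a < 1 -> differentiable G (sc a : Mat p q).
  by move=> a1; apply: (proj2 holG); exact: opnorm_le_Omega.
have dh (a : C^o) : normc a < 1 -> differentiable h a.
  by move=> a1; apply: differentiable_comp => //; apply: differentiable_comp => //; exact: dG.
have h0 : h 0 = 0 by rewrite /h /= sc0 G0 /phi mulmx0 mul0mx mxE.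
pose M' := Num.sqrt (sqnorm u * sqnorm w).
have hM (a : C^o) : normc a < 1 -> normc (h a) <= M'.
  move=> a1; rewrite /M' -[leLHS]ger0_norm ?normc_ge0 // -sqrtr_sqr.
  apply: ler_wsqrtr; apply: le_trans (cauchy_schwarz _ _) _.
  rewrite ler_wpM2r ?sqnorm_ge0 //.
  have /Omega_IP H := proj1 holG _ (opnorm_le_Omega M1 a1).
  have [->|u0] := eqVneq u 0; first by rewrite mul0mx !sqnorm0.
  by have := H u u0 => /ltW.
have z1 : normc (0 : C) < 1 by rewrite normc0.
have dhE : 'd h 0 1 = phi ('d G 0 M) :> C.
  rewrite /h diff_comp //; last by apply: differentiable_comp => //; exact: dG.
  rewrite /= (diff_mx_linear phiL) /= diff_comp //; last exact: dG.
  by rewrite /= sc0 diff_val /sc scale1r.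
have cd : has_cderiv h 0 (phi ('d G 0 M)).
  apply/is_derive_cderivP; rewrite -dhE -deriveE; last exact: dh.
  by apply: derivableP; apply: diff_derivable; exact: dh.
have le1 := schwarz dh hM h0 cd.
rewrite expr1n mul1r -[leRHS]sqr_sqrtr ?mulr_ge0 ?sqnorm_ge0 //.
by rewrite ler_pXn2r ?nnegrE ?normc_ge0 ?sqrtr_ge0.
Qed.

End SchwarzMatrix.

End HermitianNorm.

(** * Automorphisms moving a point to the origin *)

Section Mobius.
Context {R : realType}.
Local Notation C := R[i].

Definition signature_mx p q : 'M[C]_(p + q) := block_mx 1%:M 0 0 (- 1%:M).

Definition pseudo_unitary p q (M : 'M[C]_(p + q)) :=
  M *m signature_mx p q *m M ^t* = signature_mx p q.

(** A point Z is seen as the subspace spanned by the rows of (1 Z), on which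
    pseudo-unitary matrices act on the right. *)
Definition frame p q (M : 'M[C]_(p + q)) (Z : 'M[C]_(p, q)) : 'M[C]_(p, p + q) :=
  row_mx 1%:M Z *m M.

Definition mobius p q (M : 'M[C]_(p + q)) (Z : 'M[C]_(p, q)) : 'M[C]_(p, q) :=
  cramer_inv (lsubmx (frame M Z)) *m rsubmx (frame M Z).

Lemma signature_form p q m (X : 'M[C]_(m, p + q)) :
  X *m signature_mx p q *m X ^t* = lsubmx X *m (lsubmx X) ^t* - rsubmx X *m (rsubmx X) ^t*.
Proof.
rewrite -{1 2}[X]hsubmxK /signature_mx mul_row_block !mulmx0 !mulmx1 addr0 add0r mulmxN mulmx1.
by rewrite tr_row_mx map_col_mx mul_row_col mulNmx.
Qed.

Section PseudoUnitary.
Variables (p q : nat) (M : 'M[C]_(p + q)).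
Hypothesis puM : pseudo_unitary M.

(** 1 - Z Z^* is the indefinite form restricted to the rows of (1 Z), hence the
    action of M preserves its positivity. *)
Lemma frame_sqnorm Z u :
  sqnorm (u *m lsubmx (frame M Z)) - sqnorm (u *m rsubmx (frame M Z)) =
    sqnorm u - sqnorm (u *m Z).
Proof.
have E : lsubmx (frame M Z) *m (lsubmx (frame M Z)) ^t* -
    rsubmx (frame M Z) *m (rsubmx (frame M Z)) ^t* = 1%:M - Z *m Z ^t*.
  rewrite -signature_form /frame trmxCM !mulmxA -(mulmxA _ M) -(mulmxA _ (M *m _)) puM.
  by rewrite signature_form row_mxKl row_mxKr trmx1 map_mx1 mulmx1.
have Q m (N : 'M[C]_(p, m)) : (u *m (N *m N ^t*) *m u ^t*) 0 0 = (sqnorm (u *m N))%:C.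
  by rewrite -sqnormE trmxCM !mulmxA.
apply: complexI; rewrite !rmorphB /= -!Q.
have split_sub (A B : 'M[C]_p) : (u *m (A - B) *m u ^t*) 0 0 =
    (u *m A *m u ^t*) 0 0 - (u *m B *m u ^t*) 0 0.
  by rewrite mulmxBr mulmxBl [LHS]mxE [X in _ + X]mxE.
by rewrite -split_sub E split_sub mulmx1 sqnormE.
Qed.

Lemma frame_unit Z : Omega_I R p q Z -> lsubmx (frame M Z) \in unitmx.
Proof.
move=> /Omega_IP OZ; rewrite -row_free_unit -kermx_eq0; apply/eqP/row_matrixP => i.
rewrite row0; set u := row i _; apply/eqP; rewrite -[_ == _]negbK; apply/negP => u0.
have uW : u *m lsubmx (frame M Z) = 0 by rewrite /u -row_mul mulmx_ker row0.
have := frame_sqnorm Z u; rewrite uW sqnorm0 sub0r => E.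
by have := OZ u u0; have := sqnorm_ge0 (u *m rsubmx (frame M Z)); lra.
Qed.

Lemma frameE Z : Omega_I R p q Z ->
  frame M Z = lsubmx (frame M Z) *m row_mx 1%:M (mobius M Z).
Proof.
move=> OZ; rewrite mul_mx_row mulmx1 /mobius cramer_invE ?frame_unit //.
by rewrite mulKVmx ?frame_unit // hsubmxK.
Qed.

Lemma mobius_Omega Z : Omega_I R p q Z -> Omega_I R p q (mobius M Z).
Proof.
move=> OZ; apply/Omega_IP => u u0.
have uW := frame_unit OZ; move/Omega_IP : (OZ) => OZ'.
pose v := u *m invmx (lsubmx (frame M Z)).
have uE : v *m lsubmx (frame M Z) = u by rewrite mulmxKV.
have v0 : v != 0 by apply: contra_neq u0 => E; rewrite -uE E mul0mx.
have := frame_sqnorm Z v; rewrite uE.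
have -> : v *m rsubmx (frame M Z) = u *m mobius M Z.
  by rewrite /mobius cramer_invE // mulmxA.
by have := OZ' v v0; lra.
Qed.

Lemma frame_differentiable (Z : @Mat R p q) :
  differentiable (frame M : @Mat R p q -> @Mat R p (p + q)) Z.
Proof.
apply: differentiable_mulmx => //; apply: differentiable_entries => i j.
case: (split_ordP j) => k ->.
  have -> : (fun y => row_mx 1%:M y i (lshift q k) : C) = cst ((1%:M : 'M[C]_p) i k).
    by apply/funext => y; rewrite row_mxEl.
  exact: differentiable_cst.
have -> : (fun y => row_mx 1%:M y i (rshift p k) : C) = (fun y => y i k).
  by apply/funext => y; rewrite row_mxEr.
exact: differentiable_coord.
Qed.

Lemma lframe_differentiable (Z : @Mat R p q) :
  differentiable (fun Y : @Mat R p q => lsubmx (frame M Y) : @Mat R p p) Z.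
Proof.
apply: differentiable_entries => i j.
have -> : (fun Y => lsubmx (frame M Y) i j : C) = (fun Y => frame M Y i (lshift q j)).
  by apply/funext => Y; rewrite mxE.
exact: differentiable_entry (frame_differentiable Z).
Qed.

Lemma rframe_differentiable (Z : @Mat R p q) :
  differentiable (fun Y : @Mat R p q => rsubmx (frame M Y) : @Mat R p q) Z.
Proof.
apply: differentiable_entries => i j.
have -> : (fun Y => rsubmx (frame M Y) i j : C) = (fun Y => frame M Y i (rshift p j)).
  by apply/funext => Y; rewrite mxE.
exact: differentiable_entry (frame_differentiable Z).
Qed.

Lemma mobius_holomorphic : holomorphic_map (Omega_I R p q) (Omega_I R p q) (mobius M).
Proof.
split=> [Z|Z OZ]; first exact: mobius_Omega.
apply: differentiable_mulmx; last exact: rframe_differentiable.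
apply: differentiable_cramer_inv; first exact: lframe_differentiable.
exact: frame_unit.
Qed.

End PseudoUnitary.

Lemma mobiusK p q (M N : 'M[C]_(p + q)) Z : pseudo_unitary M -> M *m N = 1%:M ->
  Omega_I R p q Z -> mobius N (mobius M Z) = Z.
Proof.
move=> puM MN OZ.
have uW := frame_unit puM OZ.
have E : frame N (mobius M Z) = invmx (lsubmx (frame M Z)) *m row_mx 1%:M Z.
  rewrite -[LHS](mulKmx uW); congr (_ *m _).
  by rewrite [frame N _]/frame mulmxA -frameE // /frame -mulmxA MN mulmx1.
rewrite /mobius E mul_mx_row row_mxKl row_mxKr mulmx1 cramer_invE ?unitmx_inv //.
by rewrite invmxK mulKVmx.
Qed.

Lemma pseudo_unitary_inv p q (M : 'M[C]_(p + q)) : pseudo_unitary M ->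
  exists N, [/\ pseudo_unitary N, M *m N = 1%:M & N *m M = 1%:M].
Proof.
move=> puM; pose J := signature_mx p q; have JJ : J *m J = 1%:M.
  rewrite /J /signature_mx mulmx_block !mulmx0 !mul0mx !addr0 !mulmx1 add0r mulmxN mulNmx mulmx1 opprK.
  by rewrite scalar_mx_block.
have JC : J ^t* = J.
  by rewrite /J /signature_mx tr_block_mx map_block_mx !linearN /= !trmx1 !trmx0 map_mxN !map_mx1 !map_mx0.
have MN : M *m (J *m M ^t* *m J) = 1%:M by rewrite !mulmxA puM.
have NM := mulmx1C MN.
exists (J *m M ^t* *m J); split=> //.
rewrite /pseudo_unitary !trmxCM JC trmxCK -/J.
have -> : J *m M ^t* *m J *m J *m (J *m (M *m J)) = J *m M ^t* *m J *m (J *m J) *m M *m J.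
  by rewrite !mulmxA.
by rewrite JJ mulmx1 NM mul1mx.
Qed.

Lemma mobius_Aut p q (M : 'M[C]_(p + q)) : pseudo_unitary M ->
  Aut (Omega_I R p q) (mobius M).
Proof.
move=> puM; split; first exact: mobius_holomorphic.
have [N [puN MN NM]] := pseudo_unitary_inv puM.
exists (mobius N); split; first exact: mobius_holomorphic.
- by move=> Z OZ; apply: mobiusK.
- by move=> Z OZ; apply: mobiusK.
Qed.

(** D is an inverse square root of 1 - a a^*, up to a unitary factor on the
    right; this freedom allows a blockwise choice when a is block-diagonal. *)
Definition inv_root p q (a : 'M[C]_(p, q)) (D : 'M[C]_p) :=
  (1%:M - a *m a ^t*) *m (D *m D ^t*) = 1%:M.

(** The pseudo-unitary matrix of a map sending a to 0. *)
Definition move_mx p q (a : 'M[C]_(p, q)) (D : 'M[C]_p) (A : 'M[C]_q) : 'M[C]_(p + q) :=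
  block_mx D (- (a *m A)) (- (a ^t* *m D)) A.

Section Move.
Variables (p q : nat) (a : 'M[C]_(p, q)) (D : 'M[C]_p) (A : 'M[C]_q).
Hypotheses (aD : inv_root a D) (aA : inv_root (a ^t*) A).

Lemma inv_root_swap : a *m (A *m A ^t*) = D *m D ^t* *m a.
Proof.
have h1 := mulmx1C aD; have := aA; rewrite /inv_root trmxCK => h2.
rewrite -[LHS]mul1mx -h1 -!mulmxA; congr (D *m (D ^t* *m _)).
rewrite mulmxA [(_ - _) *m a]mulmxBl mul1mx -[a in RHS]mulmx1 -h2 !mulmxA.
by rewrite mulmxBr mulmx1 !mulmxA.
Qed.

Lemma pseudo_unitary_move : pseudo_unitary (move_mx a D A).
Proof.
have h1 := aD; have := aA; rewrite /inv_root trmxCK => h2.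
have h1' := mulmx1C aD.
have sw := inv_root_swap.
rewrite /pseudo_unitary /move_mx /signature_mx mulmx_block !mulmx0 !mulmx1 !addr0 !add0r !mulmxN !mulmx1 opprK.
rewrite tr_block_mx map_block_mx mulmx_block !linearN /= !map_mxN /= !trmxCM trmxCK.
rewrite !mulmxN !mulNmx.
have e1 : D *m D ^t* - a *m A *m (A ^t* *m a ^t*) = 1%:M.
  have -> : a *m A *m (A ^t* *m a ^t*) = a *m (A *m A ^t*) *m a ^t* by rewrite !mulmxA.
  by rewrite sw -mulmxA -{1}[D *m _]mulmx1 -mulmxBr h1'.
have e2 : a ^t* *m D *m (D ^t* *m a) - A *m A ^t* = - 1%:M.
  have -> : a ^t* *m D *m (D ^t* *m a) = a ^t* *m (D *m D ^t* *m a) by rewrite !mulmxA.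
  by rewrite -sw [a ^t* *m _]mulmxA -h2 mulmxBl mul1mx opprB.
have e3 : D *m (D ^t* *m a) = a *m A *m A ^t* by rewrite -mulmxA sw !mulmxA.
have e4 : a ^t* *m D *m D ^t* = A *m (A ^t* *m a ^t*).
  have := congr1 (fun X => X ^t*) sw; rewrite !trmxCM !trmxCK => e.
  by rewrite mulmxA e !mulmxA.
by congr block_mx; rewrite ?opprK ?e1 ?e2 ?e3 ?e4 // addrC subrr.
Qed.

Lemma frame_move_r Z : rsubmx (frame (move_mx a D A) Z) = (Z - a) *m A.
Proof.
by rewrite /frame /move_mx mul_row_block row_mxKr mul1mx mulmxBl addrC.
Qed.

Lemma frame_move_l Z : lsubmx (frame (move_mx a D A) Z) = (1%:M - Z *m a ^t*) *m D.
Proof.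
by rewrite /frame /move_mx mul_row_block row_mxKl mul1mx mulmxBl mul1mx mulmxN mulmxA.
Qed.

Lemma mobius_move_eq0 : mobius (move_mx a D A) a = 0.
Proof. by rewrite /mobius frame_move_r subrr mul0mx mulmx0. Qed.

(** The second factor of the map is (Z - a) A and vanishes at a, so only the
    value of the inverse there contributes, and it is D^* by [inv_root]. *)
Lemma diff_mobius_move H : Omega_I R p q a ->
  'd (mobius (move_mx a D A) : @Mat R p q -> @Mat R p q) (a : @Mat R p q) H =
    D ^t* *m H *m A.
Proof.
move=> Oa; set M := move_mx a D A.
have [_ /(_ _ Oa) dM] := mobius_holomorphic pseudo_unitary_move.
rewrite -deriveE //.
pose g (t : C^o) : @Mat R p q := cramer_inv (lsubmx (frame M (t *: H + a))) *m (H *m A).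
have dl (t : C^o) : differentiable (fun t : C^o => t *: H + a : @Mat R p q) t.
  by apply: differentiableD => //; exact: ex_diff.
pose line (t : C^o) : @Mat R p q := t *: H + a.
pose lfr (Y : @Mat R p q) : @Mat R p p := lsubmx (frame M Y).
have dL : differentiable (lfr \o line) 0.
  by apply: differentiable_comp; [exact: dl|exact: lframe_differentiable].
have uL : (lfr \o line) 0 \in unitmx.
  rewrite /= /lfr /line scale0r add0r; apply: frame_unit => //; exact: pseudo_unitary_move.
have gc : {for 0, continuous g}.
  apply: differentiable_continuous.
  apply: (@differentiable_mulmx _ _ _ _ _ (fun t => cramer_inv ((lfr \o line) t)) (cst (H *m A))).
    exact: differentiable_cramer_inv dL uL.
  exact: differentiable_cst.
have g0 : g 0 = D ^t* *m H *m A.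
  rewrite /g scale0r add0r frame_move_l cramer_invE; last first.
    by rewrite -frame_move_l; apply: frame_unit => //; exact: pseudo_unitary_move.
  have DD : (1%:M - a *m a ^t*) *m D *m D ^t* = 1%:M by rewrite -mulmxA.
  have [uL' _] := mulmx1_unit DD.
  by rewrite -[D ^t*](mulKmx uL') DD mulmx1 mulmxA.
rewrite -g0; apply: cvg_lim => //.
have gc' : g t @[t --> (0 : C^o)^'] --> g 0 by apply: cvg_within_filter; exact: gc.
apply: cvg_trans gc'.
apply: near_eq_cvg; near=> t.
have t0 : t != 0 by near: t; exact: nbhs_dnbhs_neq.
rewrite /g /= /M mobius_move_eq0 subr0 /mobius frame_move_r addrK.
by rewrite -[(t *: H) *m A]scalemxAl -scalemxAr scalerA mulVf // scale1r.
Unshelve. all: by end_near. Qed.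

End Move.

End Mobius.

(** * Linear isometries of the operator norm *)

Section Linear.
Context {R : realType}.
Local Notation C := R[i].

Lemma Omega_adj p q (a : 'M[C]_(p, q)) : Omega_I R p q a -> Omega_I R q p (a ^t*).
Proof.
move=> /Omega_IP Oa; apply/Omega_IP => v v0; set x := v *m a ^t*.
have [->|x0] := eqVneq x 0; first by rewrite sqnorm0 sqnorm_gt0.
have xa : sqnorm x ^+ 2 <= sqnorm (x *m a) * sqnorm v.
  have -> : sqnorm x = normc ((x *m x ^t*) 0 0).
    by rewrite sqnormE /= expr0n addr0 sqrtr_sqr ger0_norm // sqnorm_ge0.
  by rewrite {2}/x trmxCM trmxCK mulmxA; exact: cauchy_schwarz.
have x1 : 0 < sqnorm x by rewrite sqnorm_gt0.
have v1 : 0 < sqnorm v by rewrite sqnorm_gt0.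
have lt2 : sqnorm (x *m a) * sqnorm v < sqnorm x * sqnorm v by rewrite ltr_pM2r // Oa.
by have := le_lt_trans xa lt2; rewrite expr2 ltr_pM2l.
Qed.

(** Diagonalize 1 - a a^* by a unitary matrix S and take S^* d^(-1/2). *)
Lemma inv_root_exists p q (a : 'M[C]_(p, q)) : Omega_I R p q a ->
  exists D, inv_root a D.
Proof.
move=> [Hh Hp]; rewrite /inv_root; set H := 1%:M - a *m a ^t* in Hh Hp *.
have nH : H \is normalmx by apply/normalmxP; rewrite Hh.
have /orthomx_spectralP := nH.
set S := spectralmx H; set d := spectral_diag H => HE.
have uS : S \is unitarymx by exact: spectral_unitarymx.
have SS : S *m S ^t* = 1%:M by apply/unitarymxP.
rewrite invmx_unitary // in HE.
have dpos i : 0 < d 0 i.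
  pose e : 'rV[C]_p := delta_mx 0 i; pose u := e *m S.
  have uSt : u *m S ^t* = e by rewrite /u -mulmxA SS mulmx1.
  have u0 : u != 0.
    apply/eqP => E; have := congr1 (fun X : 'rV[C]_p => X 0 i) uSt.
    by rewrite E mul0mx !mxE !eqxx => /eqP; rewrite eq_sym oner_eq0.
  have := Hp u u0; rewrite HE !mulmxA uSt -mulmxA.
  have -> : S *m u ^t* = e ^t* by rewrite /u trmxCM mulmxA SS mul1mx.
  rewrite mul_mx_diag mxE (bigD1 i) //= big1 => [|k ki].
    by rewrite !mxE !eqxx /= conjC1 mul1r mulr1 addr0.
  by rewrite !mxE (negbTE ki) /= !mul0r.
pose x : 'rV[C]_p := \row_i ((Num.sqrt (complex.Re (d 0 i)))^-1)%:C.
exists (S ^t* *m diag_mx x).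
have xx : diag_mx d *m (diag_mx x *m (diag_mx x) ^t*) = 1%:M.
  rewrite tr_diag_mx map_diag_mx !mulmx_diag -diag_const_mx; congr diag_mx.
  apply/rowP => i; rewrite !mxE.
  have [-> c0] := pos_realE (dpos i); rewrite /=.
  have cr (k : R) : Num.conj (k%:C : C) = k%:C := conjc_real k.
  rewrite cr -!rmorphM /=; congr (_%:C).
  by rewrite -invfM -expr2 sqr_sqrtr ?(ltW c0) // divff // gt_eqF.
rewrite HE trmxCM trmxCK.
rewrite -!mulmxA (mulmxA S) SS mul1mx.
rewrite (mulmxA (diag_mx x)) (mulmxA (diag_mx d)) xx mul1mx.
exact: mulmx1C.
Qed.

Lemma sqnorm_delta n (j : 'I_n) : sqnorm (delta_mx 0 j : 'rV[C]_n) = 1.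
Proof.
apply: complexI; rewrite -sqnormE trmx_delta map_delta_mx mul_delta_mx.
by rewrite mxE !eqxx.
Qed.

Lemma sqnorm_entry n (u : 'rV[C]_n) j : normc (u 0 j) ^+ 2 <= sqnorm u.
Proof.
have := cauchy_schwarz u (delta_mx 0 j); rewrite sqnorm_delta mulr1.
rewrite trmx_delta map_delta_mx mxE (bigD1 j) //= big1 => [|k kj].
  by rewrite mxE !eqxx mulr1 addr0.
by rewrite mxE (negbTE kj) mulr0.
Qed.

Lemma opnorm_le_delta m n (i : 'I_m) (j : 'I_n) (c : C) k : normc c <= k ->
  opnorm_le k (c *: delta_mx i j : 'M[C]_(m, n)).
Proof.
move=> ck u.
have -> : u *m (c *: delta_mx i j) = (c * u 0 i) *: delta_mx 0 j.
  apply/rowP => l; rewrite !mxE (bigD1 i) //= big1 => [|h hi].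
    by rewrite !mxE !eqxx /= addr0; ring.
  by rewrite !mxE (negbTE hi) /= mulr0 mulr0.
rewrite sqnormZ sqnorm_delta mulr1 normcM exprMn.
apply: ler_pM; rewrite ?sqr_ge0 ?sqnorm_entry //.
by rewrite ler_pXn2r ?nnegrE ?normc_ge0 // (le_trans _ ck) // normc_ge0.
Qed.

Lemma opnorm_le_entry m n (M : 'M[C]_(m, n)) i j k :
  0 <= k -> opnorm_le k M -> normc (M i j) <= k.
Proof.
move=> k0 H; have := H (delta_mx 0 i); rewrite sqnorm_delta mulr1 -rowE => le1.
have := le_trans (sqnorm_entry _ j) le1; rewrite mxE.
by rewrite ler_pXn2r ?nnegrE ?normc_ge0.
Qed.

Lemma opnorm_le_diag m1 m2 n1 n2 (A : 'M[C]_(m1, n1)) (B : 'M[C]_(m2, n2)) k :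
  opnorm_le k A -> opnorm_le k B -> opnorm_le k (block_mx A 0 0 B).
Proof.
move=> HA HB u; rewrite -[u]hsubmxK mul_row_block !mulmx0 addr0 add0r !sqnorm_row_mx mulrDr.
by apply: lerD; [exact: HA|exact: HB].
Qed.

Lemma opnorm_leW m n (M : 'M[C]_(m, n)) k l :
  0 <= k -> k <= l -> opnorm_le k M -> opnorm_le l M.
Proof.
move=> k0 kl H u; apply: le_trans (H u) _; apply: ler_wpM2r; first exact: sqnorm_ge0.
by rewrite ler_pXn2r ?nnegrE // (le_trans k0).
Qed.

Lemma opnorm_leZ m n (M : 'M[C]_(m, n)) k (c : R) : 0 < c ->
  opnorm_le (c * k) (c%:C *: M) <-> opnorm_le k M.
Proof.
move=> c0; have E u : sqnorm (u *m (c%:C *: M)) = c ^+ 2 * sqnorm (u *m M).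
  by rewrite -scalemxAr sqnormZ /= expr0n addr0 sqrtr_sqr ger0_norm // ltW.
have E2 u : (c * k) ^+ 2 * sqnorm u = c ^+ 2 * (k ^+ 2 * sqnorm u) by rewrite exprMn mulrA.
by split=> H u; have := H u; rewrite E E2 ler_pM2l // exprn_gt0.
Qed.

Lemma opnorm_leD m n (M N : 'M[C]_(m, n)) k l : 0 <= k -> 0 <= l ->
  opnorm_le k M -> opnorm_le l N -> opnorm_le (k + l) (M + N).
Proof.
move=> k0 l0 HM HN; apply/opnorm_leP => u w.
have t (j : R) (K : 'M[C]_(m, n)) : 0 <= j -> opnorm_le j K ->
    normc ((u *m K *m w ^t*) 0 0) <= j * Num.sqrt (sqnorm u * sqnorm w).
  move=> j0 /opnorm_leP /(_ u w) le1.
  rewrite -[leLHS]ger0_norm ?normc_ge0 // -sqrtr_sqr -[j]ger0_norm // -[`|j|]sqrtr_sqr.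
  by rewrite -sqrtrM ?sqr_ge0 //; apply: ler_wsqrtr.
rewrite mulmxDr mulmxDl; have addE (A B : 'M[C]_1) : (A + B) 0 0 = A 0 0 + B 0 0 by rewrite mxE.
rewrite addE.
have -> : (k + l) ^+ 2 * (sqnorm u * sqnorm w) = ((k + l) * Num.sqrt (sqnorm u * sqnorm w)) ^+ 2.
  by rewrite exprMn sqr_sqrtr // mulr_ge0 ?sqnorm_ge0.
rewrite ler_pXn2r ?nnegrE ?normc_ge0 ?mulr_ge0 ?addr_ge0 ?sqrtr_ge0 //.
apply: le_trans (le_normcD _ _) _; rewrite mulrDl.
by apply: lerD; exact: t.
Qed.

(** If both perturbations of diag (W, B) by +-mu N have norm at most 1, the
    parallelogram identity leaves no room for N in a row where W already has norm
    1.  Every row of the first block can be saturated by some W. *)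
Lemma corner_vanish m1 m2 n1 n2 (N : 'M[C]_(m1 + m2, n1.+1 + n2)) (mu : R) : 0 < mu ->
  (forall W : 'M[C]_(m1, n1.+1), opnorm_le 1 W -> exists B,
     opnorm_le 1 (block_mx W 0 0 B + mu%:C *: N) /\
     opnorm_le 1 (block_mx W 0 0 B - mu%:C *: N)) ->
  ulsubmx N = 0 /\ ursubmx N = 0.
Proof.
move=> mu0 H.
suff: usubmx N = 0.
  by move=> N0; rewrite /ulsubmx /ursubmx N0; split; apply/matrixP => i j; rewrite !mxE.
apply/row_matrixP => i; rewrite row0; apply: sqnorm_le0.
have d1 : opnorm_le 1 (delta_mx i 0 : 'M[C]_(m1, n1.+1)).
  by rewrite -[delta_mx _ _]scale1r; apply: opnorm_le_delta; rewrite normc1.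
have [B [hp hm]] := H _ d1.
pose u : 'rV[C]_(m1 + m2) := row_mx (delta_mx 0 i) 0.
have u1 : sqnorm u = 1 by rewrite sqnorm_row_mx sqnorm_delta sqnorm0 addr0.
have uW : u *m block_mx (delta_mx i 0 : 'M[C]_(m1, n1.+1)) 0 0 B = row_mx (delta_mx 0 0) 0.
  by rewrite mul_row_block !mulmx0 mul0mx !addr0 mul_delta_mx.
have uN : u *m N = row i (usubmx N).
  by rewrite -[N in LHS]vsubmxK mul_row_col mul0mx addr0 -rowE.
have := hp u; rewrite mulmxDr -!scalemxAr uW uN u1 expr1n => h1.
have := hm u; rewrite mulmxBr -!scalemxAr uW uN u1 expr1n => h2.
have := sqnorm_parallelogram (row_mx (delta_mx 0 0) 0 : 'rV[C]_(n1.+1 + n2)) (mu%:C *: row i (usubmx N)).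
rewrite sqnorm_row_mx sqnorm_delta sqnorm0 sqnormZ => E.
have : normc (mu%:C : C) ^+ 2 * sqnorm (row i (usubmx N)) <= 0 by lra.
by rewrite pmulr_rle0 // exprn_gt0 // /= expr0n addr0 sqrtr_sqr normr_gt0 gt_eqF.
Qed.

Section Rigidity.
Variables (r r' s s' : nat).
Local Notation BM := 'M[C]_(r.+1 + r'.+1, s.+1 + s'.+1).
Local Notation M1 := 'M[C]_(r.+1, s.+1).
Local Notation M2 := 'M[C]_(r'.+1, s'.+1).

(** The family of maps Z |-> diag(Z, t z_00 E_00): the first block alone makes
    them proper, and t measures how much the second block moves. *)
Definition corner_map (t : R) (Z : M1) : BM :=
  block_mx Z 0 0 ((t%:C * Z 0 0) *: delta_mx 0 0).

Variables (L L' : {linear BM -> BM}) (Y : M1 -> M1) (S : M1 -> M2) (x y : R).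
Hypotheses (x0 : 0 <= x) (x1 : x < 1) (y0 : 0 <= y).
Hypothesis LK : cancel L L'.
Hypothesis L1 : forall M, opnorm_le 1 M -> opnorm_le 1 (L M).
Hypothesis L'1 : forall M, opnorm_le 1 M -> opnorm_le 1 (L' M).
Hypothesis LW : forall X, L (corner_map x X) = block_mx (Y X) 0 0 (S X).
Hypothesis Y1 : forall X, opnorm_le 1 X -> opnorm_le 1 (Y X).
Hypothesis Ysurj : forall W, opnorm_le 1 W -> exists2 X, opnorm_le 1 X & Y X = W.
Hypothesis Sy : forall X, opnorm_le 1 X -> opnorm_le y (S X).

(** The vector e of the corner satisfies |V + c e| <= 1 for all the images V of the
    unit ball as soon as |c| <= 1 - x.  By [corner_vanish], applied to L e and to
    its adjoint, L e lives in the second block; then L (V + e) has norm at most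
    1 + y, whereas V + e has an entry 1 + x when V is the image of E_00. *)
Lemma corner_map_rigidity : x <= y.
Proof.
pose e : BM := block_mx 0 0 0 (delta_mx 0 0).
pose N := L e.
have mu0 : 0 < 1 - x by rewrite subr_gt0.
have y1' : 0 < 1 + y by rewrite ltr_pwDl.
have pert (c : R) X : `|c| <= 1 - x -> opnorm_le 1 X -> opnorm_le 1 (corner_map x X + c%:C *: e).
  move=> cx X1.
  have -> : corner_map x X + c%:C *: e = block_mx X 0 0 ((x%:C * X 0 0 + c%:C) *: delta_mx 0 0).
    by rewrite /corner_map /e scale_block_mx !scaler0 add_block_mx !addr0 scalerDl.
  apply: opnorm_le_diag => //; apply: opnorm_le_delta.
  apply: le_trans (le_normcD _ _) _; rewrite normcM /= !expr0n !addr0 !sqrtr_sqr.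
  have := opnorm_le_entry 0 0 ler01 X1; rewrite (ger0_norm x0) => h.
  have : x * normc (X 0 0) <= x * 1 by rewrite ler_wpM2l.
  by lra.
have corner W : opnorm_le 1 W -> exists B,
     opnorm_le 1 (block_mx W 0 0 B + (1 - x)%:C *: N) /\
     opnorm_le 1 (block_mx W 0 0 B - (1 - x)%:C *: N).
  move=> W1; have [X X1 <-] := Ysurj W1; exists (S X); rewrite -LW -linearZ -linearD -linearB.
  have muE : `|1 - x| <= 1 - x by rewrite ger0_norm // ltW.
  split; apply: L1; first exact: pert.
  by rewrite -scaleNr -rmorphN; apply: pert => //; rewrite normrN.
have [Nul Nur] : ulsubmx N = 0 /\ ursubmx N = 0 by exact: corner_vanish mu0 corner.
have cornerT W : opnorm_le 1 W -> exists B,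
     opnorm_le 1 (block_mx W 0 0 B + (1 - x)%:C *: (N ^t*)) /\
     opnorm_le 1 (block_mx W 0 0 B - (1 - x)%:C *: (N ^t*)).
  move=> W1; have [B [h1 h2]] := corner _ (opnorm_le_adj W1); exists (B ^t*).
  have E : (block_mx (W ^t*) 0 0 B) ^t* = block_mx W 0 0 (B ^t*).
    by rewrite tr_block_mx map_block_mx !trmx0 !map_mx0 trmxCK.
  have EZ : ((1 - x)%:C *: N) ^t* = (1 - x)%:C *: (N ^t*).
    by rewrite linearZ /= map_mxZ; congr (_ *: _); exact: conjc_real.
  split.
    by have := opnorm_le_adj h1; rewrite linearD /= map_mxD E EZ.
  by have := opnorm_le_adj h2; rewrite linearB /= map_mxB E EZ.
have [_ Ndl] := corner_vanish mu0 cornerT.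
have {}Ndl : dlsubmx N = 0.
  apply/matrixP => i j; have := congr1 (fun Q : 'M[C]_(_, _) => (Q j i)^*) Ndl.
  by rewrite !mxE conjcK conjc0.
have N1 : opnorm_le 1 N.
  apply: L1; apply: opnorm_le_diag; first by move=> u; rewrite mulmx0 sqnorm0 mulr_ge0 ?sqr_ge0 ?sqnorm_ge0.
  by rewrite -[delta_mx _ _]scale1r; apply: opnorm_le_delta; rewrite normc1.
have NE : N = block_mx 0 0 0 (drsubmx N) by rewrite -[LHS]submxK Nul Nur Ndl.
have Ndr : opnorm_le 1 (drsubmx N).
  move=> u; have := N1 (row_mx 0 u); rewrite NE mul_row_block !mulmx0 ?mul0mx !addr0 ?add0r.
  by rewrite !sqnorm_row_mx !sqnorm0 !add0r block_mxKdr.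
pose E0 : M1 := delta_mx 0 0.
have E01 : opnorm_le 1 E0 by rewrite /E0 -[delta_mx _ _]scale1r; apply: opnorm_le_delta; rewrite normc1.
have big : opnorm_le (1 + y) (L (corner_map x E0 + e)).
  rewrite linearD LW -/N NE add_block_mx !addr0; apply: opnorm_le_diag.
    by apply: opnorm_leW (Y1 E01); rewrite ?lerDl.
  by rewrite addrC; apply: opnorm_leD => //; exact: Sy.
have y1 : 0 < (1 + y)^-1 by rewrite invr_gt0.
have big' : opnorm_le (1 + y) (corner_map x E0 + e).
  apply/(opnorm_leZ _ _ y1); rewrite mulVf; last by rewrite gt_eqF.
  rewrite -[corner_map _ _ + e]LK -linearZ; apply: L'1.
  move/(opnorm_leZ _ _ y1) : big; by rewrite mulVf // gt_eqF.
have y2 : 0 <= 1 + y by exact: ltW.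
have := opnorm_le_entry (rshift r.+1 0) (rshift s.+1 0) y2 big'.
rewrite /corner_map /e add_block_mx block_mxEdr !mxE !eqxx /= !mulr1.
rewrite !(mul0r, mulr0, subr0, addr0) expr0n addr0 sqrtr_sqr.
by rewrite ger0_norm ?addr_ge0 // addrC lerD2l.
Qed.

End Rigidity.

End Linear.

(** * Differentials of automorphisms fixing the origin *)

Section OriginDifferential.
Context {R : realType}.
Local Notation C := R[i].

Lemma Omega_diag m1 m2 n1 n2 (A : 'M[C]_(m1, n1)) (B : 'M[C]_(m2, n2)) :
  Omega_I R (m1 + m2) (n1 + n2) (block_mx A 0 0 B) <->
  Omega_I R m1 n1 A /\ Omega_I R m2 n2 B.
Proof.
have E u v : sqnorm (row_mx u v *m block_mx A 0 0 B) = sqnorm (u *m A) + sqnorm (v *m B).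
  by rewrite mul_row_block !mulmx0 addr0 add0r sqnorm_row_mx.
split=> [/Omega_IP H|[/Omega_IP HA /Omega_IP HB]].
  split; apply/Omega_IP => u u0.
    have := H (row_mx u 0); rewrite E mul0mx sqnorm_row_mx !sqnorm0 !addr0; apply.
    by apply: contra_neq u0 => /(congr1 lsubmx); rewrite row_mxKl linear0.
  have := H (row_mx 0 u); rewrite E mul0mx sqnorm_row_mx !sqnorm0 !add0r; apply.
  by apply: contra_neq u0 => /(congr1 rsubmx); rewrite row_mxKr linear0.
have le m n (Z : 'M[C]_(m, n)) : (forall u, u != 0 -> sqnorm (u *m Z) < sqnorm u) ->
    forall u, sqnorm (u *m Z) <= sqnorm u.
  by move=> HZ u; have [->|/HZ/ltW//] := eqVneq u 0; rewrite mul0mx !sqnorm0.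
apply/Omega_IP => w; rewrite -[w]hsubmxK E sqnorm_row_mx => w0.
have [u0|u0] := eqVneq (lsubmx w) 0; last by apply: ltr_leD; [exact: HA|exact: le].
apply: ler_ltD; first exact: le.
by apply: HB; apply: contra_neq w0 => v0; rewrite u0 v0 row_mx0.
Qed.

Lemma Omega_opnorm_le m n (Z : 'M[C]_(m, n)) : Omega_I R m n Z -> opnorm_le 1 Z.
Proof.
move=> /Omega_IP H u; rewrite expr1n mul1r.
by have [->|/H/ltW//] := eqVneq u 0; rewrite mul0mx !sqnorm0.
Qed.

(** Only directional derivatives along matrices of norm at most 1 are compared,
    since their small multiples lie in the domain; the elementary matrices are
    among them and span. *)
Lemma diff_eq_on_Omega m n (W : normedModType C) (f g : @Mat R m n -> W) M :
  differentiable f (0 : @Mat R m n) -> differentiable g (0 : @Mat R m n) ->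
  (forall Z, Omega_I R m n Z -> f Z = g Z) ->
  'd f (0 : @Mat R m n) M = 'd g (0 : @Mat R m n) M.
Proof.
move=> df dg fg.
have key (N : @Mat R m n) : opnorm_le 1 (N : 'M[C]_(m, n)) ->
    'd f (0 : @Mat R m n) N = 'd g (0 : @Mat R m n) N.
  move=> N1.
  have ef : 'D_N f (0 : @Mat R m n) = 'd f (0 : @Mat R m n) N by exact: deriveE.
  have eg : 'D_N g (0 : @Mat R m n) = 'd g (0 : @Mat R m n) N by exact: deriveE.
  apply: etrans (esym ef) _; apply: etrans _ eg.
  apply: cvg_lim; first exact: norm_hausdorff.
  have dgN := @diff_derivable _ _ _ g (0 : @Mat R m n) N dg.
  apply: cvg_trans dgN; apply: near_eq_cvg; near=> t.
  have t1 : normc (t - 0 : C) < 1.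
    near: t; apply: nbhs_dnbhs.
    by apply/(@nbhs_normcP R (0 : C^o)); exists 1.
  rewrite subr0 in t1.
  rewrite /= !addr0 !fg //; first exact: Omega0.
  exact: opnorm_le_Omega.
have E (h : {linear @Mat R m n -> W}) : h M = \sum_i \sum_j M i j *: h (delta_mx i j).
  rewrite {1}(matrix_sum_delta M) linear_sum; apply: eq_bigr => i _.
  by rewrite linear_sum; apply: eq_bigr => j _; rewrite linearZ.
apply: etrans (E ('d f (0 : @Mat R m n))) _.
apply: etrans _ (esym (E ('d g (0 : @Mat R m n)))).
apply: eq_bigr => i _; apply: eq_bigr => j _; apply: congr1; apply: key.
by rewrite -[delta_mx _ _]scale1r; apply: opnorm_le_delta; rewrite normc1.
Unshelve. all: by end_near. Qed.

Lemma Aut_comp (V : normedModType C) (D : set V) (f g : V -> V) :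
  Aut D f -> Aut D g -> Aut D (f \o g).
Proof.
move=> [[fD df] [f' [[f'D df'] f'f ff']]] [[gD dg] [g' [[g'D dg'] g'g gg']]].
split.
  split=> [x Dx|x Dx]; first by apply: fD; exact: gD.
  by apply: differentiable_comp; [exact: dg|apply: df; exact: gD].
exists (g' \o f'); split.
- split=> [x Dx|x Dx]; first by apply: g'D; exact: f'D.
  by apply: differentiable_comp; [exact: df'|apply: dg'; exact: f'D].
- by move=> x Dx; rewrite /= f'f ?g'g //; exact: gD.
- by move=> x Dx; rewrite /= gg' ?ff' //; exact: f'D.
Qed.

(** The chain rule inverts the differential, and the Schwarz inequality applies to
    the automorphism and to its inverse. *)
Lemma Aut_differential p q (G : 'M[C]_(p, q) -> 'M[C]_(p, q)) :
  Aut (Omega_I R p q) G -> G 0 = 0 ->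
  exists L' : {linear 'M[C]_(p, q) -> 'M[C]_(p, q)},
    [/\ cancel ('d G 0) L', cancel L' ('d G 0),
      (forall M, opnorm_le 1 M -> opnorm_le 1 ('d G 0 M)) &
      (forall M, opnorm_le 1 M -> opnorm_le 1 (L' M))].
Proof.
move=> [holG [G' [holG' G'G GG']]] G0.
have O0 : Omega_I R p q 0 by exact: Omega0.
have G'0 : G' 0 = 0 by rewrite -{1}G0 G'G.
have dG : differentiable G (0 : @Mat R p q) by exact: (proj2 holG).
have dG' : differentiable G' (0 : @Mat R p q) by exact: (proj2 holG').
have chain (g f : @Mat R p q -> @Mat R p q) M :
    differentiable f (0 : @Mat R p q) -> differentiable g (0 : @Mat R p q) -> f 0 = 0 ->
    (forall Z, Omega_I R p q Z -> g (f Z) = Z) ->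
    'd g (0 : @Mat R p q) ('d f (0 : @Mat R p q) M) = M.
  move=> df dg f0 gf.
  have dgf : differentiable g (f 0) by rewrite f0.
  have cE : 'd (g \o f) (0 : @Mat R p q) M = 'd g (f 0) ('d f (0 : @Mat R p q) M).
    exact: (congr1 (fun h : _ -> _ => h M) (diff_comp df dgf)).
  rewrite f0 in cE; apply: etrans (esym cE) _.
  have dcomp : differentiable (g \o f) (0 : @Mat R p q) := (differentiable_comp df dgf).
  have did : differentiable (id : @Mat R p q -> @Mat R p q) (0 : @Mat R p q) by exact: ex_diff.
  apply: etrans (diff_eq_on_Omega M dcomp did gf) _.
  by rewrite diff_val.
exists ('d G' 0); split.
- by move=> M; apply: chain.
- by move=> M; apply: chain.
- by move=> M; apply: schwarz_matrix.
- by move=> M; apply: schwarz_matrix.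
Qed.

End OriginDifferential.

(** * The corner coefficient contracts *)

Section CornerBound.
Context {R : realType}.
Local Notation C := R[i].

Lemma trmxCZ m n (z : C) (M : 'M[C]_(m, n)) : (z *: M) ^t* = Num.conj z *: M ^t*.
Proof. by apply/matrixP => i j; rewrite !mxE rmorphM. Qed.

Lemma trmxC_delta m n i j : (delta_mx i j : 'M[C]_(m, n)) ^t* = delta_mx j i.
Proof. by rewrite trmx_delta map_delta_mx. Qed.

Lemma inv_root_delta m n (z : C) (P : 'M[C]_m.+1) :
  inv_root (z *: delta_mx 0 0 : 'M[C]_(m.+1, n.+1)) P ->
  (1 - normc z ^+ 2) * sqnorm (delta_mx 0 0 *m P) = 1.
Proof.
rewrite /inv_root => H; pose e : 'rV[C]_m.+1 := delta_mx 0 0.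
have zz : (z *: delta_mx 0 0 : 'M[C]_(m.+1, n.+1)) *m
    (z *: delta_mx 0 0 : 'M[C]_(m.+1, n.+1)) ^t* = (normc z ^+ 2)%:C *: delta_mx 0 0.
  rewrite trmxCZ trmxC_delta -scalemxAl -scalemxAr scalerA.
  by rewrite mul_delta_mx normc_sqr.
have ed : e *m delta_mx 0 0 = e by rewrite mul_delta_mx.
have := congr1 (fun X => (e *m X *m e ^t*) 0 0) H.
rewrite zz mulmx1 sqnormE sqnorm_delta mulmxA mulmxBr mulmx1 -scalemxAr ed.
rewrite -[X in (X - _) *m _]scale1r -scalerBl -!scalemxAl mxE.
have -> : e *m (P *m P ^t*) *m e ^t* = (e *m P) *m (e *m P) ^t* by rewrite trmxCM !mulmxA.
rewrite sqnormE => E; apply: complexI; rewrite rmorphM /= rmorphB /=; exact: E.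
Qed.

Lemma inv_root_row p q (b : 'M[C]_(p, q)) P (e : 'rV[C]_p) : inv_root b P ->
  sqnorm (e *m (1%:M - b *m b ^t*) *m P) = sqnorm e - sqnorm (e *m b).
Proof.
move=> H; apply: complexI; rewrite rmorphB /= -!sqnormE !trmxCM.
have -> : (1%:M - b *m b ^t*) ^t* = 1%:M - b *m b ^t*.
  by rewrite linearB /= map_mxB trmx1 map_mx1 trmxCM trmxCK.
rewrite !mulmxA -(mulmxA _ P) -(mulmxA e) H mulmx1 mulmxBr mulmx1 mulmxBl.
by rewrite !mulmxA [in LHS]mxE [X in _ + X]mxE.
Qed.

(** Schwarz-Pick for Z |-> y z_00, in differential form.  P^* H Q is the
    vector H at b carried to the origin, and P'^* _ Q' likewise carries vectors
    at c to the origin.  With beta = |b_00|^2, the first gives |H_00| <= 1 - beta and the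
    second multiplies norms by 1 / (1 - y^2 beta), which is no larger than
    1 / (1 - beta). *)
Lemma corner_bound r r' s s' (b H : 'M[C]_(r.+1, s.+1)) (y : R)
  (P : 'M[C]_r.+1) (Q : 'M[C]_s.+1) (P' : 'M[C]_r'.+1) (Q' : 'M[C]_s'.+1)
  (c := (y%:C * b 0 0) *: delta_mx 0 0 : 'M[C]_(r'.+1, s'.+1)) :
  0 <= y -> y < 1 -> Omega_I R r.+1 s.+1 b ->
  inv_root b P -> inv_root (b ^t*) Q -> inv_root c P' -> inv_root (c ^t*) Q' ->
  opnorm_le 1 (P ^t* *m H *m Q) ->
  opnorm_le y (P' ^t* *m ((y%:C * H 0 0) *: delta_mx 0 0) *m Q').
Proof.
move=> y0 y1 Ob bP bQ cP cQ K1.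
pose beta := normc (b 0 0) ^+ 2.
have beta0 : 0 <= beta by exact: sqr_ge0.
have e1 : sqnorm (delta_mx 0 0 *m b) <= 1.
  by have := Omega_opnorm_le Ob (delta_mx 0 0); rewrite sqnorm_delta mulr1 expr1n.
have betaE : beta <= sqnorm (delta_mx 0 0 *m b).
  apply: le_trans (sqnorm_entry _ 0); rewrite -rowE mxE; exact: lexx.
have betaE' : beta <= sqnorm (delta_mx 0 0 *m b ^t*).
  by apply: le_trans (sqnorm_entry _ 0); rewrite -rowE !mxE normc_conj.
have e2 : beta < 1.
  have /Omega_IP Ob' := Ob.
  have d0 : (delta_mx 0 0 : 'rV[C]_r.+1) != 0 by rewrite -sqnorm_gt0 sqnorm_delta.
  by have := Ob' _ d0; rewrite sqnorm_delta; apply: le_lt_trans.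
(* H_00 is the value of P^* H Q on two vectors of norm at most
   (1 - beta)^(1/2), because (1 - b b^* ) P inverts P^*. *)
have H00 : normc (H 0 0) <= 1 - beta.
  pose u : 'rV[C]_r.+1 := delta_mx 0 0 *m (1%:M - b *m b ^t*) *m P.
  pose w : 'rV[C]_s.+1 := delta_mx 0 0 *m (1%:M - b ^t* *m b ^t* ^t*) *m Q.
  have HE : H 0 0 = (u *m (P ^t* *m H *m Q) *m w ^t*) 0 0.
    have bP' := bP; have bQ' := mulmx1C bQ; rewrite /inv_root in bP'.
    have hQ : (1%:M - b ^t* *m b ^t* ^t*) ^t* = 1%:M - b ^t* *m b ^t* ^t*.
      by rewrite linearB /= map_mxB trmx1 map_mx1 !trmxCM !trmxCK.
    rewrite /u /w !trmxCM hQ.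
    have -> : (delta_mx 0 0 : 'rV[C]_r.+1) *m (1%:M - b *m b ^t*) *m P *m (P ^t* *m H *m Q) *m
        (Q ^t* *m ((1%:M - b ^t* *m b ^t* ^t*) *m (delta_mx 0 0 : 'rV[C]_s.+1) ^t*)) =
       delta_mx 0 0 *m ((1%:M - b *m b ^t*) *m (P *m P ^t*)) *m H *m
        (Q *m Q ^t* *m (1%:M - b ^t* *m b ^t* ^t*)) *m (delta_mx 0 0 : 'rV[C]_s.+1) ^t*.
      by rewrite !mulmxA.
    rewrite bP' bQ' !mulmx1 -rowE trmx_delta map_delta_mx -colE.
    by rewrite !mxE.
  have /opnorm_leP /(_ u w) := K1; rewrite -HE expr1n mul1r.
  rewrite (inv_root_row _ bP) (inv_root_row _ bQ) !sqnorm_delta => le1.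
  have l1 : 1 - sqnorm (delta_mx 0 0 *m b) <= 1 - beta by rewrite lerB.
  have l2 : 1 - sqnorm (delta_mx 0 0 *m b ^t*) <= 1 - beta by rewrite lerB.
  have l0 : 0 <= 1 - sqnorm (delta_mx 0 0 *m b) by rewrite subr_ge0.
  have l3 : 0 <= 1 - beta by lra.
  have : normc (H 0 0) ^+ 2 <= (1 - beta) ^+ 2.
    apply: le_trans le1 _; rewrite expr2.
    apply: le_trans (ler_wpM2l l0 l2) _; exact: ler_wpM2r.
  by rewrite ler_pXn2r ?nnegrE ?normc_ge0.
have gE : normc (y%:C * b 0 0) ^+ 2 = y ^+ 2 * beta.
  by rewrite normcM exprMn /= expr0n addr0 sqrtr_sqr real_normK ?num_real.
have yb : y ^+ 2 * beta <= beta by rewrite ler_piMl // expr_le1 // ltW.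
pose g := 1 - y ^+ 2 * beta.
have g0 : 0 < g by rewrite /g; lra.
have sP : g * sqnorm (delta_mx 0 0 *m P') = 1 by rewrite /g -gE; exact: inv_root_delta cP.
have sQ : g * sqnorm (delta_mx 0 0 *m Q') = 1.
  have cT : c ^t* = (y%:C * b 0 0)^* *: delta_mx 0 0.
    by rewrite /c trmxCZ trmxC_delta.
  by move: cQ; rewrite cT => /inv_root_delta; rewrite normc_conj gE.
have gV j n (e : 'rV[C]_n) : g * sqnorm e = j -> sqnorm e = j / g.
  by move=> <-; rewrite mulrC mulKf // gt_eqF.
apply/opnorm_leP => u w.
pose eP : 'rV[C]_r'.+1 := delta_mx 0 0; pose eQ : 'rV[C]_s'.+1 := delta_mx 0 0.
pose v1 := u *m (eP *m P') ^t*; pose v2 := eQ *m Q' *m w ^t*.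
have -> : u *m (P' ^t* *m ((y%:C * H 0 0) *: delta_mx 0 0) *m Q') *m w ^t* =
    (y%:C * H 0 0) *: (v1 *m v2).
  have -> : delta_mx 0 0 = eP ^t* *m eQ by rewrite trmxC_delta mul_delta_mx.
  by rewrite /v1 /v2 trmxCM -scalemxAr -scalemxAl -scalemxAr -scalemxAl !mulmxA.
have -> : ((y%:C * H 0 0) *: (v1 *m v2)) 0 0 = y%:C * H 0 0 * (v1 0 0 * v2 0 0).
  by rewrite mxE [(v1 *m v2) 0 0]mxE big_ord1.
rewrite !normcM !exprMn.
have c1 : normc (v1 0 0) ^+ 2 <= sqnorm u / g.
  by apply: le_trans (cauchy_schwarz _ _) _; rewrite (gV _ _ _ sP) mul1r.
have c2 : normc (v2 0 0) ^+ 2 <= sqnorm w / g.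
  by apply: le_trans (cauchy_schwarz _ _) _; rewrite (gV _ _ _ sQ) mul1r mulrC.
have -> : normc (y%:C : C) = y by rewrite /= expr0n addr0 sqrtr_sqr ger0_norm.
rewrite -mulrA ler_wpM2l ?sqr_ge0 //.
have c3 : normc (H 0 0) ^+ 2 <= g ^+ 2.
  by rewrite ler_pXn2r ?nnegrE ?normc_ge0 ?(ltW g0) // (le_trans H00) // /g; lra.
apply: le_trans (ler_pM (sqr_ge0 _) _ c3 (ler_pM (sqr_ge0 _) (sqr_ge0 _) c1 c2)) _.
  by rewrite mulr_ge0 ?sqr_ge0.
rewrite le_eqVlt; apply/orP; left; apply/eqP; field.
by rewrite gt_eqF.
Qed.

End CornerBound.

(** * The family of maps and its parameter *)

Section CornerMap.
Context {R : realType}.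
Local Notation C := R[i].
Variables (r r' s s' : nat).
Local Notation O1 := (Omega_I R r.+1 s.+1).
Local Notation O2 := (Omega_I R (r.+1 + r'.+1) (s.+1 + s'.+1)).
Local Notation V1 := (@Mat R r.+1 s.+1).
Local Notation V2 := (@Mat R (r.+1 + r'.+1) (s.+1 + s'.+1)).
Local Notation corner_map := (@corner_map R r r' s s').

Lemma corner_map_linear t : linear (corner_map t).
Proof.
move=> a X Y; rewrite /corner_map scale_block_mx !scaler0 add_block_mx !addr0.
by congr block_mx; rewrite !mxE scalerA -scalerDl; congr (_ *: _); ring.
Qed.

HB.instance Definition _ t :=
  GRing.isLinear.Build C V1 V2 *:%R (corner_map t) (corner_map_linear t).

Lemma corner_map_differentiable t (Z : V1) : differentiable (corner_map t : V1 -> V2) Z.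
Proof. exact: mx_linear_differentiable. Qed.

Lemma diff_corner_map t (Z : V1) : 'd (corner_map t : V1 -> V2) Z = corner_map t :> (V1 -> V2).
Proof. exact: diff_mx_linear. Qed.

Lemma corner_block_Omega t (Z : V1) : 0 <= t -> t < 1 -> O1 Z ->
  Omega_I R r'.+1 s'.+1 ((t%:C * Z 0 0) *: delta_mx 0 0).
Proof.
move=> t0 t1 OZ; apply: opnorm_le_Omega.
  by rewrite -[delta_mx _ _]scale1r; apply: opnorm_le_delta; rewrite normc1.
have Z1 := opnorm_le_entry 0 0 ler01 (Omega_opnorm_le OZ).
rewrite normcM /= expr0n addr0 sqrtr_sqr ger0_norm //.
by apply: le_lt_trans t1; rewrite ler_piMr.
Qed.

Lemma corner_map_Omega t (Z : V1) : 0 <= t -> t < 1 -> O1 Z -> O2 (corner_map t Z).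
Proof. by move=> t0 t1 OZ; apply/Omega_diag; split => //; exact: corner_block_Omega. Qed.

Lemma corner_map_holomorphic t : 0 <= t -> t < 1 ->
  holomorphic_map O1 O2 (corner_map t).
Proof.
by move=> t0 t1; split=> [Z OZ|Z _]; [exact: corner_map_Omega|exact: corner_map_differentiable].
Qed.

Lemma corner_mapK t Z : ulsubmx (corner_map t Z) = Z.
Proof. by rewrite block_mxKul. Qed.

(** The first block is a left inverse, so the preimage of K is the image under
    it of the compact part of K that lies on the closed graph. *)
Lemma corner_map_proper t : proper_map O1 O2 (corner_map t).
Proof.
move=> K KO cK.
have dul (M : V2) : differentiable (ulsubmx : V2 -> V1) M.
  apply: differentiable_entries => i j.
  have -> : (fun y : V2 => (ulsubmx y) i j : C) = (fun y => y (lshift _ i) (lshift _ j)).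
    by apply/funext => y; rewrite !mxE.
  exact: differentiable_coord.
have cul : continuous (ulsubmx : V2 -> V1).
  by move=> M; apply: differentiable_continuous; exact: dul.
pose graph : set V2 := [set M | corner_map t (ulsubmx M) = M].
pose defect (M : V2) : V2 := corner_map t (ulsubmx M) - M.
have cdef : continuous defect.
  move=> M; apply: differentiable_continuous.
  have dw : differentiable ((corner_map t : V1 -> V2) \o (ulsubmx : V2 -> V1)) M.
    exact: differentiable_comp (dul M) (corner_map_differentiable t _).
  have did : differentiable (id : V2 -> V2) M by exact: ex_diff.
  exact: (differentiableB dw did).
have cg : closed graph.
  have -> : graph = defect @^-1` [set 0].
    apply/seteqP; split=> M; rewrite /graph /defect /=; first by move=> ->; rewrite subrr.
    by move/eqP; rewrite subr_eq0 => /eqP.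
  apply: (preimage_closed (f := defect)); first by move=> M _; exact: cdef.
  by apply: accessible_closed_set1; apply: hausdorff_accessible; exact: norm_hausdorff.
have -> : O1 `&` corner_map t @^-1` K = (ulsubmx : V2 -> V1) @` (K `&` graph).
  apply/seteqP; split=> [Z [OZ KZ]|_ [M [KM gM] <-]].
    by exists (corner_map t Z); [split=> //; rewrite /graph /= corner_mapK|exact: corner_mapK].
  have gE : corner_map t (ulsubmx M) = M := gM.
  have : O2 (corner_map t (ulsubmx M)) by rewrite gE; exact: KO.
  by move=> /Omega_diag[OM _]; split => //=; rewrite gE.
apply: continuous_compact.
  exact: continuous_subspaceT.
exact: compact_closedI.
Qed.

(** Move a = A 0 and b = B 0 to the origins by block-diagonal Moebius maps.  The
    differentials at 0 are then isometries L and Y related by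
    L (corner_map x X) = diag (Y X, S X), where S has norm at most y, and
    [corner_map_rigidity] compares x with y. *)
Lemma corner_map_param_le (x y : R) (A : V2 -> V2) (B : V1 -> V1) :
  0 <= x -> x < 1 -> 0 <= y -> y < 1 -> Aut O2 A -> Aut O1 B ->
  (forall Z, O1 Z -> corner_map y (B Z) = A (corner_map x Z)) -> x <= y.
Proof.
move=> x0 x1 y0 y1 AutA AutB AB.
have O0 : O1 0 by exact: Omega0.
pose b := B 0; pose c := (y%:C * b 0 0) *: delta_mx 0 0 : 'M[C]_(r'.+1, s'.+1).
have Ob : O1 b by case: AutB => -[BO _] _; exact: BO.
have Oc : Omega_I R r'.+1 s'.+1 c by exact: corner_block_Omega.
pose a : V2 := corner_map y b.
have Oa : O2 a by exact: corner_map_Omega.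
have w0 : corner_map x 0 = 0.
  by rewrite /corner_map mxE mulr0 scale0r; exact: block_mx0.
have aE : A 0 = a by rewrite -w0; exact: esym (AB 0 O0).
have [P bP] := inv_root_exists Ob; have [Q bQ] := inv_root_exists (Omega_adj Ob).
have [P' cP] := inv_root_exists Oc; have [Q' cQ] := inv_root_exists (Omega_adj Oc).
have root_diag m1 m2 n1 n2 (b1 : 'M[C]_(m1, n1)) (b2 : 'M[C]_(m2, n2)) D1 D2 :
    inv_root b1 D1 -> inv_root b2 D2 -> inv_root (block_mx b1 0 0 b2) (block_mx D1 0 0 D2).
  rewrite /inv_root => h1 h2.
  rewrite !tr_block_mx !map_block_mx !trmx0 !map_mx0 !mulmx_block !mulmx0 !mul0mx !addr0 !add0r.
  rewrite scalar_mx_block opp_block_mx add_block_mx !oppr0 !addr0.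
  by rewrite mulmx_block !mulmx0 !mul0mx !addr0 !add0r h1 h2.
have aP : inv_root (a : 'M[C]_(_, _)) (block_mx P 0 0 P') by exact: root_diag.
have aQ : inv_root ((a : 'M[C]_(_, _)) ^t*) (block_mx Q 0 0 Q').
  by rewrite tr_block_mx map_block_mx !trmx0 !map_mx0; exact: root_diag.
pose Phi : V2 -> V2 := mobius (move_mx a (block_mx P 0 0 P') (block_mx Q 0 0 Q')).
pose Psi : V1 -> V1 := mobius (move_mx b P Q).
have AutPhi : Aut O2 Phi by apply: mobius_Aut; exact: pseudo_unitary_move.
have AutPsi : Aut O1 Psi by apply: mobius_Aut; exact: pseudo_unitary_move.
have AutA1 : Aut O2 (Phi \o A) by exact: Aut_comp.
have AutB1 : Aut O1 (Psi \o B) by exact: Aut_comp.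
have A10 : (Phi \o A) 0 = 0 by rewrite /= aE; exact: mobius_move_eq0.
have B10 : (Psi \o B) 0 = 0 by exact: mobius_move_eq0.
have [L' [LK _ L1 L'1]] := Aut_differential AutA1 A10.
have [Y' [YK Y'K Y1 Y'1]] := Aut_differential AutB1 B10.
have dA : differentiable A (0 : V2) := proj2 (proj1 AutA) 0 (@Omega0 R _ _).
have dB : differentiable B (0 : V1) := proj2 (proj1 AutB) 0 O0.
have dPhi : differentiable Phi a := proj2 (proj1 AutPhi) a Oa.
have dPsi : differentiable Psi b := proj2 (proj1 AutPsi) b Ob.
pose H X := 'd B (0 : V1) X.
have chain (U V W : normedModType C) (f : U -> V) (g : V -> W) (u : U) X :
    differentiable f u -> differentiable g (f u) -> 'd (g \o f) u X = 'd g (f u) ('d f u X).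
  by move=> df dg; exact: (congr1 (fun h : _ -> _ => h X) (diff_comp df dg)).
have YE X : 'd (Psi \o B) (0 : V1) X = P ^t* *m H X *m Q.
  by apply: etrans (chain _ _ _ B Psi (0 : V1) X dB dPsi) _; exact: diff_mobius_move.
have LW X : 'd (Phi \o A) (0 : V2) (corner_map x X) =
    block_mx ('d (Psi \o B) (0 : V1) X) 0 0
      (P' ^t* *m ((y%:C * H X 0 0) *: delta_mx 0 0) *m Q').
  rewrite YE.
  have dw := corner_map_differentiable x (0 : V1).
  have dPhiA : differentiable Phi (A 0) by rewrite aE.
  have dA1 : differentiable (Phi \o A) (corner_map x 0 : V2).
    by rewrite w0; exact: (differentiable_comp dA dPhiA).
  have e1 : 'd ((Phi \o A) \o corner_map x) (0 : V1) X = 'd (Phi \o A) (0 : V2) (corner_map x X).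
    apply: etrans (chain _ _ _ (corner_map x : V1 -> V2) (Phi \o A) (0 : V1) X dw dA1) _.
    by rewrite w0 diff_corner_map.
  have dyB : differentiable ((corner_map y : V1 -> V2) \o B) (0 : V1).
    by apply: (differentiable_comp dB); exact: corner_map_differentiable.
  have e2 : 'd (Phi \o (corner_map y \o B)) (0 : V1) X =
      'd Phi a (corner_map y (H X)).
    apply: etrans (chain _ _ _ (corner_map y \o B : V1 -> V2) Phi (0 : V1) X dyB dPhi) _.
    congr ('d Phi a _).
    apply: etrans (chain _ _ _ B (corner_map y : V1 -> V2) (0 : V1) X dB (corner_map_differentiable y b)) _.
    by rewrite diff_corner_map.
  rewrite -e1.
  have -> : 'd ((Phi \o A) \o corner_map x) (0 : V1) X = 'd (Phi \o (corner_map y \o B)) (0 : V1) X.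
    apply: diff_eq_on_Omega; first exact: (differentiable_comp dw dA1).
      exact: (differentiable_comp dyB dPhi).
    by move=> Z OZ; rewrite /= AB.
  rewrite e2; apply: etrans (diff_mobius_move aP aQ _ Oa) _.
  rewrite tr_block_mx map_block_mx !trmx0 !map_mx0 /corner_map.
  by rewrite !mulmx_block !mulmx0 !mul0mx !addr0 !add0r !mul0mx.
apply: (@corner_map_rigidity _ _ _ _ _ _ L' _ _ x y x0 x1 y0 LK L1 L'1 LW Y1).
  by move=> W W1; exists (Y' W); [exact: Y'1|exact: Y'K].
move=> X X1; apply: (corner_bound y0 y1 Ob bP bQ cP cQ).
by rewrite -YE; exact: Y1.
Qed.

End CornerMap.

(** * Uncountably many classes *)

Section Family.
Context {R : realType}.
Local Notation C := R[i].

Lemma uncountable_unit_interval : ~ countable [set t : R | 0 < t < 1].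
Proof.
move=> /countable_lebesgue_measure0.
have -> : [set t : R | 0 < t < 1] = `]0, 1[%classic.
  by apply/seteqP; split=> t /=; rewrite in_itv.
by rewrite lebesgue_measure_itv /= lte_fin ltr01 sube0 => /eqP; rewrite onee_eq0.
Qed.

Lemma corner_map_inj r r' s s' : injective (@corner_map R r r' s s').
Proof.
move=> t u tu.
have := congr1 (fun f : 'M[C]_(r.+1, s.+1) -> 'M[C]_(r.+1 + r'.+1, s.+1 + s'.+1) =>
  f (delta_mx 0 0) (rshift r.+1 0) (rshift s.+1 0)) tu.
by rewrite /corner_map !block_mxEdr !mxE !eqxx !mulr1 => /complexI.
Qed.

(** The sizes p and q are related to the block sizes by equations, so that the
    sizes 2r - 1 and 2s are reached without casts. *)
Lemma uncountable_corner_family r r' s s' p q :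
  p = (r.+1 + r'.+1)%N -> q = (s.+1 + s'.+1)%N ->
  exists F : set ('M[C]_(r.+1, s.+1) -> 'M[C]_(p, q)),
    [/\ ~ countable F,
        forall f, F f -> holomorphic_map (Omega_I R r.+1 s.+1) (Omega_I R p q) f /\
          proper_map (Omega_I R r.+1 s.+1) (Omega_I R p q) f
      & forall f g, F f -> F g -> f <> g ->
          ~ equivalent_maps (Omega_I R r.+1 s.+1) (Omega_I R p q) f g].
Proof.
move=> -> ->; exists (corner_map r' s' @` [set t : R | 0 < t < 1]); split.
- move=> cF; apply: uncountable_unit_interval.
  have inj : {in [set t : R | 0 < t < 1] &, injective (@corner_map R r r' s s')}.
    by move=> t u _ _; exact: corner_map_inj.
  by rewrite -(eq_countable (inj_card_eq inj)).
- move=> _ [t /andP[t0 t1] <-]; split; first exact: corner_map_holomorphic (ltW t0) t1.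
  exact: corner_map_proper.
- move=> _ _ [t /andP[t0 t1] <-] [u /andP[u0 u1] <-] tu [A [B [AutA AutB E]]].
  apply: tu; congr corner_map; apply/le_anti/andP; split.
    case: (AutA) => hA [A' [hA' A'A AA']].
    apply: (@corner_map_param_le _ _ _ _ _ t u A' B) => //; try exact: ltW.
      by split=> //; exists A; split.
    move=> Z OZ; have OBZ := proj1 (proj1 AutB) Z OZ.
    apply: etrans (congr1 A' (esym (E Z OZ))); apply: esym; apply: A'A.
    exact: corner_map_Omega (ltW u0) u1 OBZ.
  case: (AutB) => hB [B' [hB' B'B BB']].
  apply: (@corner_map_param_le _ _ _ _ _ u t A B') => //; try exact: ltW.
    by split=> //; exists B; split.
  by move=> Z OZ; apply: etrans (E _ (proj1 hB' Z OZ)) _; rewrite (BB' Z OZ).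
Qed.

End Family.

Theorem theorem1p2 (R : realType) (r s : nat)
    (hr : (2 <= r)%N) (hs : (2 <= s)%N) (hrs : (r <= s)%N) :
  exists F : set ('M[R[i]]_(r, s) -> 'M[R[i]]_(2 * r - 1, 2 * s)),
    [/\ ~ countable F,
        forall f, F f ->
          holomorphic_map (Omega_I R r s) (Omega_I R (2 * r - 1) (2 * s)) f /\
          proper_map (Omega_I R r s) (Omega_I R (2 * r - 1) (2 * s)) f
      & forall f g, F f -> F g -> f <> g ->
          ~ equivalent_maps (Omega_I R r s) (Omega_I R (2 * r - 1) (2 * s)) f g].
Proof.
case: r hr hrs => [|[|r]] // _ _; case: s hs => [//|s] _.
apply: (@uncountable_corner_family R r.+1 r s s); last by rewrite mul2n -addnn.
by rewrite mul2n -addnn addSn addnS subn1.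
Qed.
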